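(* Fix $\alpha>0$ and $0<\varepsilon<1$. Let $\phi$ be a fixed polynomial (with integer coefficients, regarded modulo $p$). There are a constant $C_\phi$ depending only on the degree of $\phi$, and constants $c>0$ and an implied constant depending on $\varepsilon$ (and on the fixed data $\alpha,\phi$, but not on $n$, $p$), such that the following holds. Let $p$ be a prime with $C_\phi\le p\le n^{(1-\varepsilon)/2}$ such that $\phi$ is irreducible over $\mathbb{F}_p$, with $\deg(\phi)$ its degree over $\mathbb{F}_p$. Let $M$ be a random $n\times n$ matrix whose entries are iid copies of an $\alpha$-balanced random variable in $\mathbb{F}_p$. Then $$\Big|\mathbf{P}\big(\phi(x)\mid\det(M-x)\big)-\Big[1-\prod_{i=1}^{\infty}\big(1-p^{-i\deg(\phi)}\big)\Big]\Big|=O\big(\exp(-c\,n^{1-\varepsilon}/p^2)\big),$$ where divisibility is in $\mathbb{F}_p[x]$.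
   Context: A random variable $\xi$ taking values in $\mathbb{F}_p$ is called $\alpha$-balanced if $\max_{a\in\mathbb{F}_p}\mathbf{P}(\xi=a)\le 1-\alpha$. The polynomial $\det(M-x)=\det(M-xI_n)\in\mathbb{F}_p[x]$ is the characteristic polynomial of $M$. *)

(* Defs.v *)
From HB Require Import structures.
From mathcomp Require Import all_boot all_order all_algebra.
From mathcomp Require Import all_classical all_reals all_analysis.

Set Implicit Arguments.
Unset Strict Implicit.
Unset Printing Implicit Defensive.

Import Order.TTheory GRing.Theory Num.Theory.
Import numFieldNormedType.Exports.

Local Open Scope classical_set_scope.
Local Open Scope ring_scope.

(* The discrete sigma-algebra on 'I_n.+1, hence on 'F_p, which unfolds to a
   type of ordinals. *)
HB.instance Definition _ (n : nat) := isPointed.Build 'I_n.+1 ord0.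

HB.instance Definition _ (n : nat) :=
  @isMeasurable.Build default_measure_display 'I_n.+1
    discrete_measurable discrete_measurable0
    discrete_measurableC discrete_measurableU.

Definition independent_RVs (R : realType) (d d' : measure_display)
    (T : measurableType d) (T' : measurableType d') (P : probability T R)
    (I : finType) (X : I -> {RV P >-> T'}) : Prop :=
  forall (J : {set I}) (E : I -> set T'),
    (forall i, i \in J -> measurable (E i)) ->
    P (\bigcap_(i in [set` J]) (X i @^-1` E i)) =
    (\prod_(i in J) P (X i @^-1` E i))%E.

(* The copies may live on another probability space than the variable that
   is copied. *)
Definition iid_copies (R : realType) (d d' d0 : measure_display)
    (T : measurableType d) (T' : measurableType d') (T0 : measurableType d0)
    (P : probability T R) (P0 : probability T0 R)
    (I : finType) (X : I -> {RV P >-> T'}) (xi : {RV P0 >-> T'}) : Prop :=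
  independent_RVs X /\
  forall (i : I) (E : set T'), measurable E ->
    distribution P (X i) E = distribution P0 xi E.

(* Probabilities are nonnegative, so 0 is neutral for the maximum. *)
Definition balanced (R : realType) (d : measure_display)
    (T : measurableType d) (P : probability T R) (p : nat)
    (alpha : R) (xi : {RV P >-> 'F_p}) : Prop :=
  (\big[maxe/0]_(a : 'F_p) P (xi @^-1` [set a]) <= (1 - alpha)%:E)%E.

Definition random_mx (R : realType) (d : measure_display)
    (T : measurableType d) (P : probability T R) (p n : nat)
    (X : 'I_n * 'I_n -> {RV P >-> 'F_p}) (w : T) : 'M['F_p]_n :=
  \matrix_(i, j) X (i, j) w.

(* det(M - x); mathcomp's char_poly is det(x - M). *)
Definition det_subX (F : comNzRingType) (n : nat) (M : 'M[F]_n) : {poly F} :=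
  \det (map_mx polyC M - 'X%:M).

Definition poly_mod (p : nat) (phi : {poly int}) : {poly 'F_p} :=
  map_poly intr phi.

Definition deg (F : nzRingType) (f : {poly F}) : nat := (size f).-1.

(* prod_(i >= 1) u i *)
Definition infinite_prod (R : realType) (u : nat -> R) : R :=
  limn (fun N => \prod_(1 <= i < N.+1) u i).

(* Guarantees that the limit above is a genuine one for factors in [0, 1]. *)
Lemma cvg_infinite_prod (R : realType) (u : nat -> R) :
  (forall i, 0 <= u i <= 1) ->
  (fun N => \prod_(1 <= i < N.+1) u i) @ \oo --> infinite_prod u.
Proof.
move=> u01; pose v N := \prod_(1 <= i < N.+1) u i.
have v0 N : 0 <= v N.
  by apply: prodr_ge0 => i _; case/andP: (u01 i).
suff : cvgn v by [].
apply: nonincreasing_is_cvgn.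
  apply/nonincreasing_seqP => N; rewrite /v big_nat_recr //=.
  by apply: ler_piMr; [exact: v0|case/andP: (u01 N.+1)].
by exists 0 => _ [N _ <-]; exact: v0.
Qed.

(* Main.v *)
(* Let q = p ^ deg phi, F the field of q elements, lam a root of phi in F, and e a
   nontrivial additive character of F.  Then phi divides det(M - x) iff M - lam is
   singular, and one shows that the determinant is nonzero with probability close to
   \prod_(1 <= i <= n) (1 - q ^- i) by adding the columns of M - lam one at a time:
   the next column is in the span of the first j ones iff it is orthogonal to their
   left kernel K, which has q ^ (n - j) elements if they are independent.
   While n - j > m, Odlyzko's lemma makes this probability exponentially small.
   Afterwards, it equals q ^- (n - j) up to rho ^ m by Fourier inversion over K, where
   rho < 1 bounds |E z ^ xi| for the p-th roots of unity z <> 1, provided that every nonzero w in K has more than m coordinates with e(w_i) != 1.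
   That this fails is unlikely by a union bound over w, organized by the subgroup S
   spanned by the a such that a w is also sparse in this sense: the larger S, the
   less the condition on w damps the probability that w is in K, but the fewer such
   w there are. *)

Require Import Defs.
From HB Require Import structures.
From mathcomp Require Import all_boot all_order all_algebra all_field.
From mathcomp Require Import all_classical all_reals all_analysis.
From mathcomp Require Import complex ring lra.

Set Implicit Arguments.
Unset Strict Implicit.
Unset Printing Implicit Defensive.

Import Order.TTheory GRing.Theory Num.Theory.
Import numFieldNormedType.Exports.

Local Open Scope ring_scope.

(** * Product weights on a finite power *)

Section ProductWeight.

Variables (R : numDomainType) (I T : finType) (mu : T -> R).
Implicit Types (f : {ffun I -> T}) (G : {ffun I -> T} -> R).

(** Weights of independent coordinates. The construction is used at two levels: with [mu] for the
    entries of a column, and with [prodw mu] for the columns of a matrix. *)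
Definition prodw f : R := \prod_i mu (f i).

Definition pexp G : R := \sum_f prodw f * G f.

Definition upd f (i : I) (t : T) : {ffun I -> T} :=
  [ffun j => if j == i then t else f j].

Lemma updE f i t j : upd f i t j = if j == i then t else f j.
Proof. by rewrite ffunE. Qed.

Lemma upd_same f i t : upd f i t i = t.
Proof. by rewrite updE eqxx. Qed.

Lemma upd_other f i t j : j != i -> upd f i t j = f j.
Proof. by move=> ji; rewrite updE (negbTE ji). Qed.

Lemma pexp_prod (g : I -> T -> R) :
  pexp (fun f => \prod_i g i (f i)) = \prod_i \sum_t mu t * g i t.
Proof.
rewrite bigA_distr_bigA; apply: eq_bigr => f _ /=.
by rewrite /prodw -big_split.
Qed.

Lemma eq_pexp G G' : G =1 G' -> pexp G = pexp G'.
Proof. by move=> GG'; apply: eq_bigr => f _; rewrite GG'. Qed.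

Lemma pexpD G G' : pexp (fun f => G f + G' f) = pexp G + pexp G'.
Proof. by rewrite -big_split; apply: eq_bigr => f _; rewrite mulrDr. Qed.

Lemma pexpN G : pexp (fun f => - G f) = - pexp G.
Proof. by rewrite -sumrN; apply: eq_bigr => f _; rewrite mulrN. Qed.

Lemma pexpB G G' : pexp (fun f => G f - G' f) = pexp G - pexp G'.
Proof. by rewrite pexpD pexpN. Qed.

Lemma pexpZ a G : pexp (fun f => a * G f) = a * pexp G.
Proof. by rewrite mulr_sumr; apply: eq_bigr => f _; rewrite mulrCA. Qed.

Lemma pexp_sum (J : finType) (P : pred J) (G : J -> {ffun I -> T} -> R) :
  pexp (fun f => \sum_(j | P j) G j f) = \sum_(j | P j) pexp (G j).
Proof. by rewrite exchange_big; apply: eq_bigr => f _; rewrite mulr_sumr. Qed.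

Hypothesis mu_ge0 : forall t, 0 <= mu t.

Lemma prodw_ge0 f : 0 <= prodw f.
Proof. by apply: prodr_ge0. Qed.

Lemma ler_pexp G G' : (forall f, G f <= G' f) -> pexp G <= pexp G'.
Proof. by move=> GG'; apply: ler_sum => f _; rewrite ler_wpM2l ?prodw_ge0. Qed.

Lemma pexp_ge0 G : (forall f, 0 <= G f) -> 0 <= pexp G.
Proof. by move=> G0; apply: sumr_ge0 => f _; rewrite mulr_ge0 ?prodw_ge0. Qed.

Lemma ler_norm_pexp G : `|pexp G| <= pexp (fun f => `|G f|).
Proof.
apply: le_trans (ler_norm_sum _ _ _) _; apply: ler_sum => f _.
by rewrite normrM (ger0_norm (prodw_ge0 f)).
Qed.

Hypothesis mu_sum1 : \sum_t mu t = 1.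

Lemma pexp_cst a : pexp (fun=> a) = a.
Proof.
have := pexp_prod (fun _ _ => 1); rewrite /pexp => p1.
rewrite -mulr_suml; suff -> : \sum_f prodw f = 1 by rewrite mul1r.
transitivity (\sum_f prodw f * \prod_(i : I) (1 : R)).
  by apply: eq_bigr => f _; rewrite big1 ?mulr1.
rewrite p1; apply: big1 => i _; rewrite -[RHS]mu_sum1.
by apply: eq_bigr => t _; rewrite mulr1.
Qed.

Lemma prodw_sum1 : \sum_f prodw f = 1.
Proof.
by rewrite -[RHS](pexp_cst 1); apply: eq_bigr => f _; rewrite mulr1.
Qed.

(* The pairs (f, t) and (upd f i t, f i) have the same weight. *)
Lemma resample (i : I) G :
  pexp G = pexp (fun f => \sum_t mu t * G (upd f i t)).
Proof.
pose h (ft : {ffun I -> T} * T) := (upd ft.1 i ft.2, ft.1 i).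
have hK : involutive h.
  move=> [f t]; rewrite /h /= upd_same; congr pair.
  by apply/ffunP => j; rewrite !updE; case: eqP => // ->.
transitivity (\sum_f \sum_t prodw f * mu t * G f).
  apply: eq_bigr => f _; rewrite -mulr_suml -mulr_sumr mu_sum1 mulr1 //.
transitivity (\sum_f \sum_t prodw f * mu t * G (upd f i t)); last first.
  apply: eq_bigr => f _; rewrite mulr_sumr.
  by apply: eq_bigr => t _; rewrite mulrA.
rewrite !pair_bigA (reindex_inj (inv_inj hK)) /=.
apply: eq_bigr => -[f t] _ /=; congr (_ * _).
rewrite /prodw (bigD1 i) //= [in RHS](bigD1 i) //= upd_same.
under [in LHS]eq_bigr => j ji do rewrite upd_other //.
move: (\prod_(j | _) _) (mu t) (mu (f i)) => x y z.
by rewrite mulrC mulrA [RHS]mulrAC.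
Qed.

End ProductWeight.

(** * Roots of unity of prime order *)

Section RootsOfUnity.

Variables (C : numClosedFieldType) (p : nat).
Hypothesis p_pr : prime p.
Implicit Types z : C.

Lemma norm_unity z : z ^+ p = 1 -> `|z| = 1.
Proof.
move=> zp1; apply/eqP; rewrite -(@pexpr_eq1 _ _ p) ?normr_ge0 ?prime_gt0 //.
by rewrite -normrX zp1 normr1.
Qed.

(** The powers of z sum to 0, so p is the sum of the 1 - z^k for k < p. As |1 - z^k| <= k |1 - z|,
    this gives p <= |1 - z| p (p - 1) / 2. *)
Lemma unity_neq1_gap z : z ^+ p = 1 -> z != 1 -> 2 <= p%:R * `|1 - z|.
Proof.
move=> zp1 z1; have nz := norm_unity zp1.
have S0 : \sum_(k < p) z ^+ k = 0.
  have /esym/eqP := subrX1 z p; rewrite zp1 subrr mulf_eq0 subr_eq0 (negbTE z1).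
  by move=> /eqP.
have le_k k : `|1 - z ^+ k| <= k%:R * `|1 - z|.
  rewrite -[in leLHS](expr1n _ k) subrXX normrM mulrC ler_wpM2r ?normr_ge0 //.
  apply: le_trans (ler_norm_sum _ _ _) _.
  rewrite (eq_bigr (fun=> 1)) ?sumr_const ?card_ord // => i _.
  by rewrite expr1n mul1r normrX nz expr1n.
have : p%:R <= \sum_(k < p) k%:R * `|1 - z|.
  have -> : p%:R = `|\sum_(k < p) (1 - z ^+ k)|.
    by rewrite sumrB S0 subr0 sumr_const card_ord normr_nat.
  by apply: le_trans (ler_norm_sum _ _ _) _; apply: ler_sum.
have p0 : 0 < p%:R :> C by rewrite ltr0n prime_gt0.
rewrite -mulr_suml -(ler_pM2r (_ : 0 < 2 :> C)) // mulrAC [leLHS]mulrC.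
have -> : (\sum_(k < p) k%:R) * 2 = p%:R * p.-1%:R :> C.
  rewrite -natr_sum -!natrM; congr _%:R.
  rewrite -(big_mkord xpredT (fun k => k)) bin2_sum bin2 muln2.
  by have := odd_double_half (p * p.-1); case: (p) => // k; rewrite oddM /=; case: odd.
rewrite mulrC -mulrA ler_pM2l // => /le_trans; apply.
by rewrite ler_wpM2r ?normr_ge0 // ler_nat leq_pred.
Qed.

Lemma unity_neq1_prim z : z ^+ p = 1 -> z != 1 -> p.-primitive_root z.
Proof.
move=> zp1 z1; have [m zm mp] := prim_order_exists (prime_gt0 p_pr) zp1.
have [_ /(_ m mp)/orP[/eqP m1|/eqP <- //]] := primeP p_pr.
by case/eqP: z1; have := prim_expr_order zm; rewrite m1 expr1.
Qed.

Lemma Fp_ltn (k : 'F_p) : (k < p)%N.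
Proof. by rewrite -[X in (_ < X)%N](Fp_cast p_pr) ltn_ord. Qed.

Lemma unity_exp_inj z (k l : 'F_p) :
  z ^+ p = 1 -> z != 1 -> z ^+ k = z ^+ l -> k = l.
Proof.
move=> zp1 z1 /eqP; rewrite (eq_prim_root_expr (unity_neq1_prim zp1 z1)).
by rewrite !modn_small ?Fp_ltn // => /eqP/val_inj.
Qed.

Variables (mu : 'F_p -> C) (alpha : C).
Hypotheses (mu_ge0 : forall k, 0 <= mu k) (mu_sum1 : \sum_k mu k = 1).
Hypothesis mu_le : forall k, mu k <= 1 - alpha.

(** For independent xi and eta of law [mu], 2 - 2 |E z^xi|^2 is the mean of |z^xi - z^eta|^2. By
    [unity_neq1_gap] this is at least (2/p)^2 P(xi != eta), and xi = eta has probability at most 1 -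
    alpha. *)
Lemma norm_char_mean z : z ^+ p = 1 -> z != 1 ->
  `|\sum_k mu k * z ^+ k| ^+ 2 <= 1 - 2 * alpha / p%:R ^+ 2.
Proof.
move=> zp1 z1; have p0 : 0 < p%:R :> C by rewrite ltr0n prime_gt0.
have zkp k : (z ^+ k) ^+ p = 1 by rewrite exprAC zp1 expr1n.
have conj_z k : (z ^+ k) * (z ^+ k)^* = 1.
  by rewrite -normCK norm_unity ?expr1n.
have muC k : (mu k)^* = mu k by apply: geC0_conj.
have sq_sum : \sum_k \sum_l mu k * mu l * `|z ^+ k - z ^+ l| ^+ 2 =
    2 - 2 * `|\sum_k mu k * z ^+ k| ^+ 2.
  have -> : `|\sum_k mu k * z ^+ k| ^+ 2 =
      \sum_k \sum_l mu k * mu l * (z ^+ k * (z ^+ l)^*).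
    rewrite normCK rmorph_sum mulr_suml; apply: eq_bigr => k _.
    rewrite mulr_sumr; apply: eq_bigr => l _ /=.
    by rewrite rmorphM /= [(mu l)^*]muC mulrACA.
  have two : 2 = \sum_k \sum_l mu k * mu l * 2 :> C.
    transitivity ((\sum_k mu k) * (\sum_l mu l) * 2); first by rewrite mu_sum1 !mul1r.
    rewrite mulr_suml mulr_suml; apply: eq_bigr => k _.
    by rewrite mulr_sumr mulr_suml.
  rewrite [X in _ = X - _]two.
  transitivity (\sum_k \sum_l mu k * mu l * 2
     - (\sum_k \sum_l mu k * mu l * (z ^+ k * (z ^+ l)^*)
      + \sum_k \sum_l mu k * mu l * (z ^+ l * (z ^+ k)^*))).
    rewrite -big_split -sumrB /=; apply: eq_bigr => k _.
    rewrite -big_split -sumrB /=; apply: eq_bigr => l _.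
    rewrite -mulrDr -mulrBr; congr (_ * _).
    rewrite normCK rmorphB /= mulrBl !mulrBr !conj_z.
    by ring.
  congr (_ - _); rewrite [X in _ + X]exchange_big /=.
  have -> : \sum_j \sum_i mu i * mu j * (z ^+ j * (z ^+ i)^* ) =
    \sum_k \sum_l mu k * mu l * (z ^+ k * (z ^+ l)^*).
    by apply: eq_bigr => k _; apply: eq_bigr => l _; rewrite [mu l * _]mulrC.
  by ring.
have mu_sq : \sum_k mu k * mu k <= 1 - alpha.
  rewrite -[leRHS]mul1r -mu_sum1 mulr_suml.
  by apply: ler_sum => k _; rewrite mu_sum1 ler_wpM2l.
have lower : 4 / p%:R ^+ 2 * alpha
    <= \sum_k \sum_l mu k * mu l * `|z ^+ k - z ^+ l| ^+ 2.
  apply: le_trans (_ : 4 / p%:R ^+ 2 * (1 - \sum_k mu k * mu k) <= _).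
    rewrite ler_wpM2l ?divr_ge0 ?exprn_ge0 ?ler0n // lerBrDr -lerBrDl //.
  have -> : 1 - \sum_k mu k * mu k = \sum_k \sum_(l | l != k) mu k * mu l.
    apply/eqP; rewrite subr_eq -big_split /=; apply/eqP.
    rewrite -[LHS]mul1r -{1}mu_sum1 -mu_sum1 mulr_suml; apply: eq_bigr => k _.
    by rewrite mulr_sumr (bigD1 k) //= addrC.
  rewrite mulr_sumr; apply: ler_sum => k _.
  rewrite [leRHS](bigD1 k) //= subrr normr0 expr0n mulr0 add0r mulr_sumr.
  apply: ler_sum => l lk; rewrite mulrC ler_wpM2l ?mulr_ge0 //.
  wlog lt_kl : k l lk / (l < k)%N.
    move=> IH; have [/IH->//|ge_lk] := ltnP l k.
    rewrite distrC IH 1?eq_sym // ltn_neqAle ge_lk andbT.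
    by apply: contra lk => /eqP/val_inj ->.
  have -> : z ^+ k - z ^+ l = - (1 - z ^+ (k - l)) * z ^+ l.
    by rewrite mulNr mulrBl mul1r -exprD subnK 1?ltnW // opprB.
  rewrite normrM normrN [`|z ^+ l|]norm_unity // mulr1.
  have /unity_neq1_gap : z ^+ (k - l) != 1.
    rewrite -(prim_order_dvd (unity_neq1_prim zp1 z1)) gtnNdvd ?subn_gt0 //.
    by rewrite (leq_ltn_trans (leq_subr _ _)) ?Fp_ltn.
  move=> /(_ (zkp _)) gap; rewrite ler_pdivrMr ?exprn_gt0 // -exprMn mulrC.
  have -> : 4 = 2 ^+ 2 :> C by rewrite -natrX.
  by rewrite lerXn2r ?nnegrE ?mulr_ge0 ?normr_ge0 // ltW.
move: lower; rewrite sq_sum.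
have -> : 4 / p%:R ^+ 2 * alpha = 2 * (2 * alpha / p%:R ^+ 2).
  by ring.
rewrite -[X in _ <= X - _]mulr1 -mulrBr ler_pM2l ?ltr0n // => H.
by rewrite lerBrDr addrC -lerBrDr.
Qed.

End RootsOfUnity.

(** * Fourier analysis *)

Section CharacterSums.

Variables (C : numClosedFieldType) (A : finZmodType).
Implicit Types (S : {set A}) (chi : A -> C).

(** Orthogonality of characters: translating S by some b in S with chi b != 1 preserves the sum but
    multiplies it by chi b. *)
Lemma char_sum S chi : zmod_closed S -> {morph chi : a b / a + b >-> a * b} ->
  \sum_(a in S) chi a = (#|S| * [forall a in S, chi a == 1%R])%:R.
Proof.
move=> [S0 SB] chiD; case: (boolP [forall a in S, _]) => [/forall_inP triv|].
  rewrite muln1 -sumr_const; apply: eq_bigr => a aS.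
  by apply/eqP/triv.
rewrite negb_forall_in muln0 => /exists_inP[b bS chib].
have SD a : (a + b \in S) = (a \in S).
  apply/idP/idP => [abS|aS]; first by rewrite -(addrK b a) SB.
  by rewrite -(opprK b) SB // -(sub0r b) SB.
have : \sum_(a in S) chi a = chi b * \sum_(a in S) chi a.
  rewrite {1}(reindex_inj (addIr b)) /= mulr_sumr (eq_bigl _ _ SD).
  by apply: eq_bigr => a _; rewrite chiD mulrC.
move=> /eqP; rewrite -subr_eq0 -[X in X - _]mul1r -mulrBl mulf_eq0 subr_eq0.
by rewrite eq_sym (negbTE chib) => /eqP.
Qed.

End CharacterSums.

Section Fourier.

Variables (C : numClosedFieldType) (p : nat) (mu : 'F_p -> C) (alpha rho : C).
Variables (F : finFieldType) (e : F -> C) (n : nat).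
Hypotheses (p_pr : prime p).
Hypotheses (mu_ge0 : forall k, 0 <= mu k) (mu_sum1 : \sum_k mu k = 1).
Hypothesis mu_le : forall k, mu k <= 1 - alpha.
Hypotheses (rho01 : 0 <= rho <= 1) (rho_sq : 1 - 2 * alpha / p%:R ^+ 2 <= rho ^+ 2).
Hypotheses (eD : {morph e : a b / a + b >-> a * b}) (e_p : forall a, e a ^+ p = 1).

Local Notation V := {ffun 'I_n -> 'F_p}.

(** [x i] acts through its representative below p, which in characteristic p is the scalar action of
    the prime field. *)
Definition dotp (w : 'rV[F]_n) (x : V) : F := \sum_i w 0 i *+ x i.

(* For e = zeta ^ tau with tau : F -> F_p linear, this is the support of tau(w). *)
Definition supp (w : 'rV[F]_n) := [set i | e (w 0 i) != 1].

Lemma dotpD w w' x : dotp (w + w') x = dotp w x + dotp w' x.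
Proof.
by rewrite -big_split; apply: eq_bigr => i _; rewrite mxE mulrnDl.
Qed.

Lemma dotpZ a w x : dotp (a *: w) x = a * dotp w x.
Proof. by rewrite mulr_sumr; apply: eq_bigr => i _; rewrite mxE mulrnAr. Qed.

Lemma character0 : e 0 = 1.
Proof.
have : e 0 * e 0 = e 0 by rewrite -eD addr0.
move=> /eqP; rewrite -subr_eq0 -[X in _ - X]mul1r -mulrBl mulf_eq0 subr_eq0.
case/orP => /eqP // e00; have := e_p 0; rewrite e00 expr0n.
by rewrite gtn_eqF ?prime_gt0 // => /eqP; rewrite eq_sym oner_eq0.
Qed.

Lemma norm_character a : `|e a| = 1.
Proof. exact: (norm_unity p_pr). Qed.

Lemma characterMn a k : e (a *+ k) = e a ^+ k.
Proof. by elim: k => [|k IH]; rewrite ?character0 // mulrS eD IH exprS. Qed.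

Lemma character_sum (I : finType) (a : I -> F) : e (\sum_i a i) = \prod_i e (a i).
Proof. exact: (big_morph e eD character0). Qed.

Lemma characterNK a : e a * e (- a) = 1.
Proof. by rewrite -eD subrr character0. Qed.

Lemma characterN_eq1 a : (e (- a) == 1) = (e a == 1).
Proof.
by apply/eqP/eqP => ea; have := characterNK a; rewrite ea ?mulr1 ?mul1r.
Qed.

(** By independence the mean is a product over the coordinates. Those in [supp w] contribute at most
    rho by [norm_char_mean], the others exactly 1. *)
Lemma norm_mean_dotp w :
  `|pexp mu (fun x : V => e (dotp w x))| <= rho ^+ #|supp w|.
Proof.
have -> : pexp mu (fun x : V => e (dotp w x)) =
    \prod_i \sum_t mu t * e (w 0 i) ^+ t.
  rewrite -(pexp_prod mu (fun i (t : 'F_p) => e (w 0 i) ^+ t)).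
  by apply: eq_pexp => x; rewrite character_sum; apply: eq_bigr => i _; rewrite characterMn.
rewrite normr_prod -prodr_const (bigID (mem (supp w))) /=.
rewrite [X in _ * X]big1 ?mulr1 => [|i]; last first.
  rewrite inE negbK => /eqP ->; under eq_bigr => t _ do rewrite expr1n mulr1.
  by rewrite mu_sum1 normr1.
apply: ler_prod => i; rewrite inE => ei1; rewrite normr_ge0 /=.
have /andP[rho0 _] := rho01.
rewrite -(@ler_pXn2r _ 2) ?nnegrE //.
by apply: le_trans (norm_char_mean p_pr mu_ge0 mu_sum1 mu_le _ _) rho_sq.
Qed.

Variables (A : finZmodType) (y : A -> 'rV[F]_n) (c : A -> F).
Hypotheses (yD : {morph y : a b / a + b}) (cD : {morph c : a b / a + b}).

(** The equations dotp (y a) x = c a, as far as the character e sees them. When the family is stable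
    under scalars of F, nothing is lost: see [solves_line] and [solves_kercol]. *)
Definition solves (S : {set A}) (x : V) :=
  [forall a in S, e (dotp (y a) x - c a) == 1].

Lemma solves_char_sum (S : {set A}) x : zmod_closed S ->
  #|S|%:R * (solves S x)%:R = \sum_(a in S) e (dotp (y a) x - c a) :> C.
Proof.
move=> S0; rewrite -natrM (char_sum S0) // => a b.
by rewrite -eD yD cD dotpD opprD addrACA.
Qed.

(* Averaging the characters over H computes the first probability; the frequencies
   in S give the second one and the others are damped by norm_mean_dotp. *)
Lemma solves_approx (H S : {set A}) m :
  zmod_closed H -> zmod_closed S -> S \subset H ->
  {in H :\: S, forall a, m <= #|supp (y a)|}%N ->
  `|pexp mu (fun x => (solves H x)%:R)
    - #|S|%:R / #|H|%:R * pexp mu (fun x => (solves S x)%:R)| <= rho ^+ m.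
Proof.
move=> Hz Sz SH dense; have /andP[rho0 rho1] := rho01.
have H0 : 0 < #|H|%:R :> C.
  by rewrite ltr0n card_gt0; apply/set0Pn; exists 0; case: Hz.
have -> : pexp mu (fun x => (solves H x)%:R)
    - #|S|%:R / #|H|%:R * pexp mu (fun x => (solves S x)%:R)
   = #|H|%:R^-1 * \sum_(a in H :\: S) pexp mu (fun x => e (dotp (y a) x - c a)).
  apply: (mulfI (lt0r_neq0 H0)); rewrite mulrA divff ?lt0r_neq0 // mul1r.
  have cancelH s X : #|H|%:R * (s / #|H|%:R * X) = s * X :> C.
    by rewrite mulrA mulrCA divff ?lt0r_neq0 // mulr1.
  rewrite mulrBr cancelH -!pexpZ.
  rewrite -pexpB -pexp_sum; apply: eq_pexp => x.
  rewrite !solves_char_sum // (big_setID S) /= (finset.setIidPr SH).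
  by rewrite addrAC subrr add0r.
rewrite normrM normfV normr_nat ler_pdivrMl //.
apply: le_trans (ler_norm_sum _ _ _) _.
apply: le_trans (_ : \sum_(a in H :\: S) rho ^+ m <= _).
  apply: ler_sum => a aHS.
  have -> : pexp mu (fun x => e (dotp (y a) x - c a)) =
      e (- c a) * pexp mu (fun x => e (dotp (y a) x)).
    by rewrite -pexpZ; apply: eq_pexp => x; rewrite eD mulrC.
  rewrite normrM norm_character mul1r; apply: le_trans (norm_mean_dotp _) _.
  by rewrite ler_wiXn2l // dense.
rewrite sumr_const -[leLHS]mulr_natl ler_wpM2r ?exprn_ge0 // ler_nat.
exact: subset_leq_card (subsetDl _ _).
Qed.

End Fourier.

(** * Anticoncentration on subspaces *)

Section Hyperplanes.

Variables (F : finFieldType) (n : nat).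
Implicit Types (H : {set 'rV[F]_n}) (l : 'rV[F]_n -> F).

(** If l does not vanish on H, some w0 in H has l w0 = 1, and (c, u) maps to c w0 + u bijectively
    from F times the kernel of l onto H. *)
Lemma card_hyperplane H l : submod_closed H ->
  (forall a u v, l (a *: u + v) = a * l u + l v) ->
  #|H| = (#|[set w in H | l w == 0%R]|
          * (if [forall w in H, l w == 0%R] then 1 else #|F|))%N.
Proof.
move=> [H0 HZ] lZ; set H' := [set w in H | l w == 0].
have l0 : l 0 = 0.
  by have := lZ (-1) 0 0; rewrite scaler0 addr0 mulN1r addNr.
case: (boolP [forall w in H, l w == 0]) => [/forall_inP lH|].
  rewrite muln1; apply: eq_card => w; rewrite inE.
  by case: (boolP (w \in H)) => //= /lH ->.
rewrite negb_forall_in => /exists_inP[w1 w1H lw1].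
pose w0 := (l w1)^-1 *: w1.
have w0H : w0 \in H by rewrite -[w0]addr0 HZ.
have lw0 : l w0 = 1 by rewrite -[w0]addr0 lZ l0 addr0 mulVf.
pose h (cu : F * 'rV[F]_n) := cu.1 *: w0 + cu.2.
have l_h c u : u \in H' -> l (h (c, u)) = c.
  by rewrite inE lZ lw0 mulr1 => /andP[_ /eqP ->]; rewrite addr0.
have h_inj : {in finset.setX [set: F] H' &, injective h}.
  move=> [c u] [c' u']; rewrite !inE /= => uH' u'H' hh.
  have cc' : c = c' by rewrite -(l_h c u) ?inE // hh l_h ?inE.
  by move: hh; rewrite /h /= cc' => /addrI ->.
have -> : H = h @: finset.setX [set: F] H'.
  apply/setP => w; apply/idP/imsetP => [wH|[[c u]]].
    exists (l w, - l w *: w0 + w); last by rewrite /h /= scaleNr addrA subrr add0r.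
    by rewrite !inE /= lZ lw0 mulr1 addNr eqxx HZ.
  by rewrite !inE /= => /andP[uH _] ->; apply: HZ.
by rewrite card_in_imset // cardsX cardsT mulnC.
Qed.

Lemma hyperplane_submod H l : submod_closed H ->
  (forall a u v, l (a *: u + v) = a * l u + l v) ->
  submod_closed [set w in H | l w == 0].
Proof.
move=> [H0 HZ] lZ; split => [|a u v]; rewrite !inE.
  by have := lZ (-1) 0 0; rewrite H0 scaler0 addr0 mulN1r addNr => ->; rewrite eqxx.
move=> /andP[uH /eqP lu] /andP[vH /eqP lv].
by rewrite HZ // lZ lu lv mulr0 addr0 eqxx.
Qed.

End Hyperplanes.

Section Anticoncentration.

Variables (C : numClosedFieldType) (p : nat) (mu : 'F_p -> C) (alpha : C).
Variables (F : finFieldType) (n : nat).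
Hypotheses (p_pr : prime p) (pF : p \in [pchar F]).
Hypotheses (mu_ge0 : forall k, 0 <= mu k) (mu_sum1 : \sum_k mu k = 1).
Hypothesis mu_le : forall k, mu k <= 1 - alpha.

Local Notation V := {ffun 'I_n -> 'F_p}.

Lemma one_sub_alpha_ge0 : 0 <= 1 - alpha.
Proof. exact: le_trans (mu_ge0 0) (mu_le 0). Qed.

(** Resample coordinate i, which G ignores: at most one of its values makes Q true, and that value
    has mass at most 1 - alpha. *)
Lemma pexp_determined i (G : V -> C) (Q : V -> bool) :
  (forall x, 0 <= G x) -> (forall x t, G (upd x i t) = G x) ->
  (forall x t t', Q (upd x i t) -> Q (upd x i t') -> t = t') ->
  pexp mu (fun x => G x * (Q x)%:R) <= (1 - alpha) * pexp mu G.
Proof.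
move=> G0 Gi Q1; rewrite (resample mu_sum1 i) -pexpZ.
apply: ler_pexp => // x; rewrite (eq_bigr (fun t => G x * (mu t * (Q (upd x i t))%:R))).
  rewrite -mulr_sumr mulrC ler_wpM2r //.
  have [t Qt|noQ] := pickP (fun t => Q (upd x i t)).
    rewrite (bigD1 t) //= Qt mulr1 big1 ?addr0 // => t' t't.
    case: (boolP (Q _)) => [/(Q1 _ _ _ Qt) tt'|_]; last by rewrite mulr0.
    by rewrite tt' eqxx in t't.
  by rewrite big1 ?one_sub_alpha_ge0 // => t _; rewrite noQ mulr0.
by move=> t _; rewrite Gi mulrCA.
Qed.

Lemma dotp_upd (w : 'rV[F]_n) (x : V) i t :
  dotp w (upd x i t) = w 0 i *+ t + dotp w (upd x i 0).
Proof.
rewrite /dotp (bigD1 i) //= [in RHS](bigD1 i) //= !upd_same mulr0n add0r.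
by congr (_ + _); apply: eq_bigr => j ji; rewrite !upd_other.
Qed.

Lemma dotp_upd_id (w : 'rV[F]_n) (x : V) i t :
  w 0 i = 0 -> dotp w (upd x i t) = dotp w x.
Proof.
move=> wi; apply: eq_bigr => j _; rewrite updE.
by case: eqP => // ->; rewrite wi !mul0rn.
Qed.

Lemma mulrn_Fp_inj (a : F) : a != 0 -> injective (fun t : 'F_p => a *+ t).
Proof.
move=> a0; suff H (t t' : 'F_p) : (t <= t')%N -> a *+ t = a *+ t' -> t = t'.
  by move=> t t' tt'; case: (leqP t t') => [/H->|/ltnW/H->].
move=> le_tt' aa; have /eqP : a *+ (t' - t) = 0 by rewrite mulrnBr // aa subrr.
rewrite -mulr_natr mulf_eq0 (negbTE a0) /= -(dvdn_pcharf pF) => dv.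
apply/val_inj/eqP; rewrite eqn_leq le_tt' /= -subn_eq0.
apply: contraTT dv; rewrite -lt0n => tt'.
by rewrite gtnNdvd // (leq_ltn_trans (leq_subr _ _)) ?Fp_ltn.
Qed.

(* Odlyzko's lemma: some coordinate is determined by the others, and the elements
   of H vanishing there still form a set of at least q ^ (r - 1) elements. *)
Lemma odlyzko (H : {set 'rV[F]_n}) (b : 'rV[F]_n -> F) r : submod_closed H ->
  (#|F| ^ r <= #|H|)%N ->
  pexp mu (fun x : V => [forall w in H, dotp w x == b w]%:R) <= (1 - alpha) ^+ r.
Proof.
elim: r H => [|r IH] H Hs cardH.
  rewrite expr0 -[leRHS](pexp_cst 'I_n mu_sum1 1); apply: ler_pexp => // x.
  by rewrite lern1 leq_b1.
have F1 : (1 < #|F|)%N := card_finRing_gt1 F.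
have [i /exists_inP[w wH wi]] : exists i, [exists w in H, w 0 i != 0].
  apply/existsP; apply: contraT; rewrite negb_exists => /forallP H0.
  suff : (#|H| <= 1)%N.
    by move=> /(leq_trans cardH); rewrite leqNgt -(exp1n r.+1) ltn_exp2r // F1.
  apply: (@leq_trans #|[set (0 : 'rV[F]_n)]|); last by rewrite cards1.
  apply/subset_leq_card/fintype.subsetP => w wH.
  rewrite inE; apply/eqP/rowP => j; rewrite mxE; apply/eqP; apply: contraT => wj.
  by have := H0 j; rewrite negb_exists_in => /forall_inP/(_ w wH); rewrite wj.
pose l (w : 'rV[F]_n) := w 0 i.
have lZ a u v : l (a *: u + v) = a * l u + l v by rewrite /l !mxE.
set H' := [set w in H | l w == 0].
apply: le_trans (_ : pexp mu (fun x : V =>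
  [forall w in H', dotp w x == b w]%:R * (dotp w x == b w)%:R) <= _).
  apply: ler_pexp => // x; rewrite -natrM ler_nat mulnb.
  case: (boolP [forall w in H, _]) => // /forall_inP Hx; rewrite Hx // andbT.
  by rewrite lt0b; apply/forall_inP => u; rewrite inE => /andP[/Hx].
rewrite exprS; apply: le_trans (_ : (1 - alpha) *
   pexp mu (fun x : V => [forall w in H', dotp w x == b w]%:R) <= _).
  apply: (pexp_determined (i := i)) => [x|x t|x t t'].  
  - by rewrite ler0n.
  - congr (nat_of_bool _)%:R; apply: eq_forallb => u; rewrite inE.
    case: (boolP (u \in H)) => //= _; case: eqP => //= ui.
    by rewrite dotp_upd_id.
  rewrite (dotp_upd w x i t) (dotp_upd w x i t') => /eqP <- /eqP /addIr.
  by move/(mulrn_Fp_inj wi) => ->.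
rewrite ler_wpM2l ?one_sub_alpha_ge0 // IH //; first exact: hyperplane_submod.
move: cardH; rewrite (card_hyperplane Hs lZ) expnSr ifF.
  by rewrite leq_pmul2r // ltnW.
by apply/negbTE; rewrite negb_forall_in; apply/exists_inP; exists w.
Qed.

End Anticoncentration.

(** * Duality in the coefficient field *)

Lemma setT_zmod (A : finZmodType) : zmod_closed [set: A].
Proof. by split=> [|? ?]; rewrite !inE. Qed.

Section Duality.

Variables (C : numClosedFieldType) (p : nat) (F : finFieldType) (e : F -> C).
Hypotheses (p_pr : prime p).
Hypotheses (eD : {morph e : a b / a + b >-> a * b}) (e_p : forall a, e a ^+ p = 1).
Hypothesis e_nt : exists b, e b != 1.
Implicit Types (S : {set F}) (s : seq F) (a u : F).

(** The annihilator of S under the pairing e(a u), which is nondegenerate because e is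
    nontrivial. *)
Definition perp S := [set u | [forall a in S, e (a * u) == 1]].

Lemma perp_zmod S : zmod_closed (perp S).
Proof.
split=> [|a b]; rewrite !inE.
  by apply/forall_inP => a _; rewrite mulr0 (character0 p_pr eD e_p).
move=> /forall_inP ea /forall_inP eb; apply/forall_inP => c cS.
by rewrite mulrBr eD (eqP (ea _ cS)) mul1r (characterN_eq1 p_pr eD e_p) eb.
Qed.

Lemma e_nt_mul u : u != 0 -> exists a, e (a * u) != 1.
Proof. by move=> u0; have [b eb] := e_nt; exists (b / u); rewrite divfK. Qed.

(** Double counting of the sum of e(a u) over u in F and a in S: for fixed u the sum over a is |S|
    or 0 according to whether u is in [perp S]; for fixed a the sum over u is q or 0 according to
    whether a = 0. *)
Lemma card_perp S : zmod_closed S -> (#|S| * #|perp S| = #|F|)%N.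
Proof.
move=> Sz; apply/eqP; rewrite -(eqr_nat C).
have -> : (#|S| * #|perp S|)%:R = \sum_u \sum_(a in S) e (a * u) :> C.
  rewrite natrM mulrC -sumr_const mulr_suml [RHS](bigID (mem (perp S))) /=.
  rewrite [X in _ = _ + X]big1 ?addr0 => [|u]; last first.
    rewrite char_sum // => [|a b]; last by rewrite mulrDl eD.
    by rewrite inE => /negbTE ->; rewrite muln0.
  apply: eq_bigr => u; rewrite char_sum // => [|a b]; last by rewrite mulrDl eD.
  by rewrite inE => ->; rewrite muln1 mul1r.
rewrite exchange_big /= (bigD1 0) /=; last by case: Sz.
rewrite [X in _ + X]big1 => [|a /andP[_ a0]].
  rewrite addr0 (eq_bigr (fun=> 1)) ?sumr_const => [|u _].
    exact/eqP.
  by rewrite mul0r (character0 p_pr eD e_p).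
rewrite (eq_bigl (mem [set: F])) => [|u]; last by rewrite !inE.
rewrite char_sum => [||u v]; [|exact: setT_zmod|by rewrite mulrDr eD].
have [b eb] := e_nt_mul a0.
rewrite (_ : [forall u in _, _] = false) ?muln0 //.
apply/negbTE; rewrite negb_forall_in; apply/exists_inP; exists b; rewrite ?inE //.
by rewrite mulrC.
Qed.

Definition perps s := [set u | all (fun a => e (a * u) == 1) s].

(* By duality, the additive subgroup generated by s. *)
Definition spans s := perp (perps s).

Lemma perpsE s : perps s = perp [set a in s].
Proof.
apply/setP => u; rewrite !inE; apply/allP/forall_inP => H a.
  by rewrite inE => /H.
by move=> as_; apply: H; rewrite inE.
Qed.

Lemma mem_spans s a : a \in s -> a \in spans s.
Proof.
move=> as_; rewrite inE; apply/forall_inP => u; rewrite inE mulrC.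
by move=> /allP/(_ a as_).
Qed.

Lemma perp_spans s : perp (spans s) = perps s.
Proof.
apply/setP => u; apply/idP/idP => [|us]; rewrite inE.
  by move=> /forall_inP us; rewrite inE; apply/allP => a /mem_spans/us.
by apply/forall_inP => a; rewrite inE => /forall_inP/(_ u us); rewrite mulrC.
Qed.

Lemma card_spans s : (#|spans s| * #|perps s| = #|F|)%N.
Proof. by rewrite -perp_spans card_perp // /spans; apply: perp_zmod. Qed.

(** Some u0 in [perps s] has e(a u0) != 1. The translates of [perps (a :: s)] by the p multiples of
    u0 lie in [perps s], and the values of e(a u) on them tell them apart. *)
Lemma card_perps_cons s a : a \notin spans s ->
  (p * #|perps (a :: s)| <= #|perps s|)%N.
Proof.
rewrite inE negb_forall_in => /exists_inP[u0 u0s]; rewrite mulrC => eu0.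
pose h (ku : 'F_p * F) := u0 *+ ku.1 + ku.2.
have h_inj : {in finset.setX [set: 'F_p] (perps (a :: s)) &, injective h}.
  move=> [k u] [l v]; rewrite !inE /= => /andP[/eqP eu _] /andP[/eqP ev _] hh.
  have kl : k = l.
    apply: (unity_exp_inj p_pr (e_p (a * u0)) eu0).
    have : e (a * h (k, u)) = e (a * h (l, v)) by rewrite hh.
    by rewrite /h /= !mulrDr !eD eu ev !mulr1 !mulrnAr !(characterMn p_pr eD e_p).
  by move: hh; rewrite /h /= kl => /addrI ->.
rewrite -{1}(card_Fp p_pr) -cardsT -cardsX -(card_in_imset h_inj).
apply/subset_leq_card/fintype.subsetP => v /imsetP[[k u]]; rewrite !inE /=.
move=> /andP[_ /allP us] ->; apply/allP => b bs; rewrite mulrDr eD mulrnAr.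
rewrite (characterMn p_pr eD e_p) (eqP (us b bs)) mulr1.
by move: u0s; rewrite inE => /allP/(_ b bs)/eqP ->; rewrite expr1n.
Qed.

(** Greedy choice: an element of T outside the current span divides [perps s] by at least p. Since q
    = p^d, after d such steps only 0 is left in [perps s], and the span is all of F. *)
Lemma spanning_tuple (T : {set F}) d : T != finset.set0 -> #|F| = (p ^ d)%N ->
  exists s : d.-tuple F, all (mem T) s && (T \subset spans s).
Proof.
move=> /set0Pn[a0 a0T] cardF.
suff H k : exists s : k.-tuple F, all (mem T) s &&
    ((T \subset spans s) || (#|perps s| * p ^ k <= #|F|)%N).
  have [s /andP[sT /orP[Ts|]]] := H d; first by exists s; rewrite sT Ts.
  rewrite cardF -{2}[(p ^ d)%N]mul1n leq_pmul2r ?expn_gt0 ?prime_gt0 // => perp1.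
  exists s; rewrite sT /=; apply/fintype.subsetP => a _; rewrite inE.
  have p0 : 0 \in perps s by rewrite perpsE; case: (perp_zmod [set a in s]).
  apply/forall_inP => u us; have /card_le1P/(_ 0 p0) := perp1.
  move=> /(_ u); rewrite us inE => /esym/eqP ->; by rewrite mul0r (character0 p_pr eD e_p).
elim: k => [|k [s /andP[sT sP]]].
  exists [tuple]; rewrite /=; apply/orP; right.
  by rewrite expn0 muln1 max_card.
have [Ts|/fintype.subsetPn[a aT as_]] := boolP (T \subset spans s).
  (* T is already spanned; the tuple is padded with a0 to reach the prescribed length. *)
  exists [tuple of a0 :: s]; rewrite /= a0T sT /=; apply/orP; left.
  apply/fintype.subsetP => a aT; have := fintype.subsetP Ts a aT; rewrite !inE.
  move=> /forall_inP H; apply/forall_inP => u; rewrite inE /= => /andP[_ us].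
  by apply: H; rewrite inE.
exists [tuple of a :: s]; rewrite /= aT sT /=; apply/orP; right.
have /negbTE notsub : ~~ (T \subset spans s) by apply/fintype.subsetPn; exists a.
rewrite notsub /= in sP; apply: leq_trans sP.
by rewrite expnS mulnA [(_ * p)%N]mulnC leq_mul2r card_perps_cons ?orbT.
Qed.

End Duality.

(** * Left kernels of the first columns *)

Section Kernels.

Variables (C : numClosedFieldType) (p : nat) (mu : 'F_p -> C) (alpha rho : C).
Variables (F : finFieldType) (e : F -> C) (lam : F) (n m d : nat).
Hypotheses (p_pr : prime p) (pF : p \in [pchar F]).
Hypotheses (mu_ge0 : forall k, 0 <= mu k) (mu_sum1 : \sum_k mu k = 1).
Hypotheses (alpha_pos : 0 <= alpha) (mu_le : forall k, mu k <= 1 - alpha).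
Hypotheses (rho01 : 0 <= rho <= 1) (rho_sq : 1 - 2 * alpha / p%:R ^+ 2 <= rho ^+ 2).
Hypotheses (eD : {morph e : a b / a + b >-> a * b}) (e_p : forall a, e a ^+ p = 1).
Hypothesis e_nt : exists b, e b != 1.
(** This expresses that lam generates F over its prime field, in terms of additive subgroups stable
    under lam. *)
Hypothesis lam_gen : forall S : {set F}, zmod_closed S -> 1 \in S ->
  (forall a, a \in S -> lam * a \in S) -> S = [set: F].
Hypotheses (cardF : #|F| = (p ^ d)%N) (m_gt0 : (0 < m)%N) (m_le : (m <= n)%N).

Local Notation V := {ffun 'I_n -> 'F_p}.
Local Notation q := #|F|.
Local Notation prodV := (@prodw C 'I_n 'F_p mu).
Local Notation PV := (@pexp C 'I_n 'F_p mu).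
Local Notation PM := (@pexp C 'I_n {ffun 'I_n -> 'F_p} (prodw mu)).

Implicit Types (M : {ffun 'I_n -> V}) (w : 'rV[F]_n) (s : seq F).

Lemma prodV_ge0 x : 0 <= prodV x.
Proof. exact: prodw_ge0. Qed.

Lemma prodV_sum1 : \sum_x prodV x = 1.
Proof. exact: prodw_sum1. Qed.

(* The left kernel of the first k columns of M - lam, where M j is column j of M. *)
Definition kercol k M : {set 'rV[F]_n} :=
  [set w | [forall j : 'I_n, (j < k)%N ==> (dotp w (M j) == lam * w 0 j)]].

Definition sparse_mul w : {set F} := [set a | (#|supp e (a *: w)| <= m)%N].

(* If s consists of elements of sparse_mul w spanning it additively, then off the
   union of the d supports of the a *: w, a in s, which has at most d * m elements
   and is enumerated by g, the entries of w are orthogonal to spans e s. *)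
Definition candidates s (g : {ffun 'I_(d * m) -> 'I_n}) : {set 'rV[F]_n} :=
  [set w | [&& w != 0, (#|supp e w| <= m)%N, all (mem (sparse_mul w)) s,
    sparse_mul w \subset spans e s &
    [forall i, (i \in codom g) || (w 0 i \in perps e s)]]].

Lemma supp_eq0 w : (forall a, supp e (a *: w) = finset.set0) -> w = 0.
Proof.
move=> w0; apply/rowP => i; rewrite [RHS]mxE; apply/eqP; apply: contraT => wi.
have [a] := e_nt_mul e_nt wi; rewrite -[_ * _]/(a * w 0 i).
by have /setP/(_ i) := w0 a; rewrite !inE mxE => ->.
Qed.

Lemma sparse_candidate w : w != 0 -> (#|supp e w| <= m)%N ->
  exists (s : d.-tuple F) g, w \in candidates s g.
Proof.
move=> w0 wm.
have T0 : sparse_mul w != finset.set0.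
  by apply/set0Pn; exists 1; rewrite inE scale1r.
have [s /andP[sT Ts]] := spanning_tuple p_pr eD e_p T0 cardF.
pose U := \bigcup_(a <- s) supp e (a *: w).
have cardU : (#|U| <= d * m)%N.
  rewrite /U -{2}(size_tuple s); elim: (tval s) sT => [|a r IH] /=.
    by rewrite big_nil cards0.
  move=> /andP[aT rT]; rewrite big_cons mulSn.
  apply: leq_trans (leq_card_setU _ _) _; rewrite leq_add ?IH //.
  by rewrite inE in aT.
have n0 : (0 < n)%N := leq_trans m_gt0 m_le.
(* If U has fewer than d * m elements, the spare arguments are sent to the index 0, which only
   enlarges [codom g]. *)
pose g := [ffun k : 'I_(d * m) => nth (Ordinal n0) (enum U) k].
exists s, g; rewrite inE w0 wm sT Ts /=; apply/forallP => i.
apply/orP; have [iU|iU] := boolP (i \in U); [left|right].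
  have lt_iU : (index i (enum U) < d * m)%N.
    by apply: leq_trans cardU; rewrite cardE index_mem mem_enum.
  apply/codomP; exists (Ordinal lt_iU).
  by rewrite ffunE /= nth_index // mem_enum.
rewrite inE; apply/allP => a /= as_; apply: contraR iU => ea.
by rewrite /U (big_rem a as_) !inE mxE ea.
Qed.

(** At most d * m coordinates, those in [codom g], range over F, and the others over [perps e s].
    The former are counted with a factor q times [#|perps e s|], so that the second power has
    exponent n. *)
Lemma card_candidates s g :
  (#|candidates s g| <= q ^ (d * m) * #|perps e s| ^ n)%N.
Proof.
pose Y i : pred F := if i \in codom g then predT else mem (perps e s).
pose h w : {ffun 'I_n -> F} := [ffun i => w 0 i].
have h_inj : injective h.
  move=> w w' /ffunP hh; apply/rowP => i.
  by have := hh i; rewrite !ffunE.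
rewrite -(card_imset _ h_inj).
apply: (@leq_trans #|family Y|).
  apply/subset_leq_card/fintype.subsetP => x /imsetP[w wc ->]; apply/familyP => i.
  rewrite ffunE /Y; case: ifP => // ig.
  by move: wc; rewrite inE => /and5P[_ _ _ _ /forallP/(_ i)]; rewrite ig.
rewrite card_family foldrE big_map big_enum /=.
have t0 : (0 < #|perps e s|)%N.
  rewrite card_gt0; apply/set0Pn; exists 0; rewrite perpsE.
  by case: (perp_zmod p_pr eD e_p [set a in s]).
apply: (@leq_trans (\prod_(i : 'I_n) ((if i \in codom g then q else 1) * #|perps e s|))).
  apply: leq_prod => i _; rewrite /Y; case: ifP => _.
    by rewrite leq_pmulr.
  by rewrite mul1n.
rewrite big_split /= [X in (_ * X)%N]prod_nat_const card_ord.
rewrite leq_mul2r; apply/orP; right.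
rewrite -big_mkcond /= prod_nat_const leq_pexp2l //.
  by rewrite ltnW // card_finRing_gt1.
by apply: leq_trans (leq_image_card _ _) _; rewrite card_ord.
Qed.

Lemma pexpV_le1 (Q : pred V) : PV (fun x => (Q x)%:R) <= 1.
Proof.
rewrite -[leRHS](pexp_cst 'I_n mu_sum1 1); apply: ler_pexp => // x.
by rewrite -[leRHS]/1%:R ler_nat leq_b1.
Qed.

Lemma solves_line w (b : F) (x : V) :
  solves e (fun a => a *: w) (fun a => a * b) [set: F] x = (dotp w x == b).
Proof.
apply/forall_inP/eqP => [H|<- a _]; last first.
  by rewrite dotpZ subrr (character0 p_pr eD e_p).
apply/eqP; rewrite -subr_eq0; apply: contraT => /(e_nt_mul e_nt)[a].
by rewrite mulrBr -dotpZ H ?inE.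
Qed.

(** All characters of F together test dotp w x = b. Those outside the span are damped by rho^m,
    since their multiples of w are not sparse; the span counts in proportion to its size, and there
    the single character a already determines x_i from the other coordinates. *)
Lemma prob_column_le w s (b : F) : sparse_mul w \subset spans e s ->
  (exists2 a, a \in spans e s & exists i, e (a * w 0 i) != 1) ->
  PV (fun x => (dotp w x == b)%:R) <=
    #|spans e s|%:R / q%:R * (1 - alpha) + rho ^+ m.
Proof.
move=> Ts [a aS [i eai]].
have yD : {morph (fun a => a *: w) : a b / a + b} by move=> ? ?; rewrite scalerDl.
have cD : {morph (fun a => a * b) : a b / a + b} by move=> ? ?; rewrite mulrDl.
have dense : {in [set: F] :\: spans e s, forall c, (m <= #|supp e (c *: w)|)%N}.
  move=> c; rewrite !inE andbT => cS; rewrite ltnW // ltnNge.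
  by apply: contra cS => cT; have := fintype.subsetP Ts c; rewrite !inE; apply.
have := solves_approx p_pr mu_ge0 mu_sum1 mu_le rho01 rho_sq eD e_p yD cD
  (setT_zmod F) (perp_zmod p_pr eD e_p (perps e s)) (finset.subsetT _) dense.
under eq_pexp => x do rewrite solves_line.
rewrite cardsT; set X := PV _; set Y := PV _ => XY.
have X0 : 0 <= X by apply: pexp_ge0 => // x; rewrite ler0n.
have Y0 : 0 <= Y by apply: pexp_ge0 => // x; rewrite ler0n.
have c0 : 0 <= #|spans e s|%:R / q%:R :> C by rewrite divr_ge0.
have Y1 : Y <= 1 - alpha.
  apply: le_trans (_ : PV (fun x => 1 * (e (a * dotp w x - a * b) == 1)%:R) <= _).
    apply: ler_pexp => // x; rewrite mul1r ler_nat.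
    case: (boolP (solves _ _ _ _ _)) => // /forall_inP/(_ a aS).
    by rewrite dotpZ => ->.
  rewrite -[leRHS]mulr1 -[X in _ <= _ * X](pexp_cst 'I_n mu_sum1 1).
  apply: (pexp_determined mu_ge0 mu_sum1 mu_le (i := i)) => // x t t'.
  rewrite (dotp_upd w x i t) (dotp_upd w x i t') !mulrDr !mulrnAr => /eqP H1 /eqP.
  rewrite -[in RHS]H1 -!addrA !eD !(characterMn p_pr eD e_p) => H2.
  apply: (unity_exp_inj p_pr (e_p (a * w 0 i)) eai).
  apply: (mulIf _ (esym H2)); rewrite -normr_eq0 normrM !(norm_character p_pr) ?mulr1 //.
rewrite -lerBlDl addrC; apply: le_trans (_ : `|X - #|spans e s|%:R / q%:R * Y| <= _) => //.
apply: le_trans (_ : X - #|spans e s|%:R / q%:R * Y <= _).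
  by rewrite [leLHS]addrC lerB // ler_wpM2l.
by apply: real_ler_norm; rewrite realB // ger0_real // mulr_ge0.
Qed.

Lemma prob_kercol_prod k w : PM (fun M => (w \in kercol k M)%:R) =
  \prod_(j : 'I_n) if (j < k)%N then PV (fun x => (dotp w x == lam * w 0 j)%:R) else 1.
Proof.
pose g (j : 'I_n) (x : V) : C := if (j < k)%N then (dotp w x == lam * w 0 j)%:R else 1.
have -> : PM (fun M => (w \in kercol k M)%:R) = PM (fun M => \prod_j g j (M j)).
  apply: eq_pexp => M; rewrite /g.
  case: (boolP (w \in kercol k M)) => [|]; rewrite inE; first move=> /forallP H.
    by rewrite big1 // => j _; case: ifP => // jk; have := H j; rewrite jk /= => ->.
  rewrite negb_forall => /existsP[j]; rewrite negb_imply => /andP[jk /negbTE wj].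
  by rewrite (bigD1 j) //= jk wj mul0r.
rewrite pexp_prod; apply: eq_bigr => j _; rewrite /g; case: ifP => // _.
by rewrite -[RHS]prodV_sum1; apply: eq_bigr => x _; rewrite mulr1.
Qed.

(* The column j < n - m imposes a *: w . x = a * lam * w_j for a in S := spans e s.
   If all characters e (a * w_i) with a in S are trivial, then the event has
   probability 0 unless e (a * lam * w_j) = 1 for all these j; in that case lam * a
   is in sparse_mul w, so that S is stable under lam, hence S = F and w = 0. *)
Lemma prob_candidate_le s g w : w \in candidates s g ->
  PM (fun M => (w \in kercol (n - m) M)%:R) <=
    (#|spans e s|%:R / q%:R * (1 - alpha) + rho ^+ m) ^+ (n - m).
Proof.
rewrite inE => /and5P[w0 wm sT Ts /forallP wg].
have [rho0 _] := andP rho01; have a0 := one_sub_alpha_ge0 mu_ge0 mu_le.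
have b0 : 0 <= #|spans e s|%:R / q%:R * (1 - alpha) + rho ^+ m.
  by rewrite addr_ge0 ?exprn_ge0 // mulr_ge0 // divr_ge0.
have [/exists_inP[a aS /existsP[i eai]]|triv] :=
    boolP [exists a in spans e s, [exists i, e (a * w 0 i) != 1]].
  rewrite prob_kercol_prod -big_mkcond /=.
  apply: le_trans (_ : \prod_(j in [pred j : 'I_n | (j < n - m)%N])
    (#|spans e s|%:R / q%:R * (1 - alpha) + rho ^+ m) <= _).
    apply: ler_prod => j _; rewrite pexp_ge0 //= prob_column_le //.
    by exists a => //; exists i.
  rewrite prodr_const (_ : #|[pred j : 'I_n | (j < n - m)%N]| = n - m)%N //.
  rewrite -sum1_card (eq_bigl (fun j : 'I_n => (j < n - m)%N)) //.
  rewrite -(big_ord_widen n (fun=> 1%N)) ?leq_subr //.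
  by rewrite sum1_card card_ord.
have {}triv a i : a \in spans e s -> e (a * w 0 i) = 1.
  move=> aS; apply/eqP; apply: contraT => eai; case/negP: triv.
  by apply/exists_inP; exists a => //; apply/existsP; exists i.
have [S1|] := boolP [forall a in spans e s, [forall j : 'I_n, (j < n - m)%N ==>
    (e (a * (lam * w 0 j)) == 1)]].
  have lamS a : a \in spans e s -> lam * a \in spans e s.
    move=> aS; apply: (fintype.subsetP Ts); rewrite inE.
    (* By [S1] the support of [(lam * a) *: w] lies among the last m indices. *)
    apply: (@leq_trans #|[set j : 'I_n | (n - m <= j)%N]|).
      apply/subset_leq_card/fintype.subsetP => j; rewrite !inE mxE -mulrA mulrCA.
      apply: contraR; rewrite -ltnNge => jn.
      have /forallP/(_ j) := forall_inP S1 a aS.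
      by rewrite jn.
    rewrite -sum1_card (eq_bigl (fun j : 'I_n => ~~ (j < n - m)%N)) => [|j]; last first.
      by rewrite inE leqNgt.
    have := sum1_card (predT : pred 'I_n); rewrite card_ord.
    rewrite (bigID (fun j : 'I_n => (j < n - m)%N)) /=.
    rewrite -(big_ord_widen n (fun=> 1%N)) ?leq_subr // sum1_card card_ord.
    by move=> nE; rewrite -(leq_add2l (n - m)) nE subnK.
  have S_T : spans e s = [set: F].
    apply: lam_gen => //; first exact: (perp_zmod p_pr eD e_p).
    by apply: (fintype.subsetP Ts); rewrite inE scale1r.
  case/eqP: w0; apply: supp_eq0 => a; apply/setP => i.
  by rewrite !inE mxE triv ?eqxx // S_T inE.
rewrite negb_forall_in => /exists_inP[a aS].
rewrite negb_forall => /existsP[j]; rewrite negb_imply => /andP[jn eaj].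
rewrite prob_kercol_prod (bigD1 j) //= jn.
rewrite [X in X * _](_ : _ = 0) ?mul0r ?exprn_ge0 //.
apply: big1 => x _; rewrite (_ : (dotp w x == lam * w 0 j) = false) ?mulr0 //.
apply: contraNF eaj => /eqP <-; rewrite -dotpZ (character_sum p_pr eD e_p).
by rewrite big1 // => i _; rewrite (characterMn p_pr eD e_p) mxE triv ?expr1n.
Qed.

Definition bad M := [exists w in kercol (n - m) M, (w != 0) && (#|supp e w| <= m)%N].

(** In order: the tuples s, the maps g, the values of w on [codom g], a bound for m of the n factors
    [#|perps e s|], and the other n - m of them merged with the probabilities of the n - m
    columns. *)
Definition bad_bound : C := q%:R ^+ d * n%:R ^+ (d * m) * q%:R ^+ (d * m) * q%:R ^+ m
  * (1 - alpha + q%:R * rho ^+ m) ^+ (n - m).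

(** Union bound over all candidates. A large span makes the probability per candidate large but
    leaves few candidates, and the two effects compensate. *)
Lemma prob_bad_le : PM (fun M => (bad M)%:R) <= bad_bound.
Proof.
have [rho0 _] := andP rho01; have a0 := one_sub_alpha_ge0 mu_ge0 mu_le.
have q0 : 0 < q%:R :> C by rewrite ltr0n ltnW // card_finRing_gt1.
apply: le_trans (_ : PM (fun M => \sum_(s : d.-tuple F)
  \sum_(g : {ffun 'I_(d * m) -> 'I_n}) \sum_(w in candidates s g)
    (w \in kercol (n - m) M)%:R) <= _).
  apply: ler_pexp => [|M]; first exact: prodV_ge0.
  have [/exists_inP[w wK /andP[w0 wm]]|_] := boolP (bad M); last first.
    by do 3 (apply: sumr_ge0 => ? _); rewrite ler0n.
  have [s [g wc]] := sparse_candidate w0 wm.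
  rewrite (bigD1 s) //= (bigD1 g) //= (bigD1 w) //= wK -!addrA lerDl.
  rewrite !addr_ge0 //; first by apply: sumr_ge0 => ? _; rewrite ler0n.
    by do 2 (apply: sumr_ge0 => ? _); rewrite ler0n.
  by do 3 (apply: sumr_ge0 => ? _); rewrite ler0n.
rewrite pexp_sum; under eq_bigr => s _ do rewrite pexp_sum.
under eq_bigr => s _ do under eq_bigr => g _ do rewrite pexp_sum.
pose B0 : C := q%:R ^+ (d * m) * q%:R ^+ m * (1 - alpha + q%:R * rho ^+ m) ^+ (n - m).
apply: le_trans (_ : \sum_(s : d.-tuple F)
  \sum_(g : {ffun 'I_(d * m) -> 'I_n}) B0 <= _); last first.
  rewrite !sumr_const card_tuple card_ffun !card_ord -mulrnA -[leLHS]mulr_natl.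
  by rewrite natrM !natrX /bad_bound /B0 -!mulrA mulrCA.
apply: ler_sum => s _; apply: ler_sum => g _.
set t := #|perps e s|; set u := #|spans e s|.
have qE : q%:R = u%:R * t%:R :> C by rewrite -natrM (card_spans p_pr eD e_p e_nt).
have t0 : 0 < t%:R :> C.
  by move: q0; rewrite qE !ltr0n -natrM ltr0n muln_gt0 => /andP[].
have u0 : 0 < u%:R :> C.
  by move: q0; rewrite qE !ltr0n -natrM ltr0n muln_gt0 => /andP[].
have tq : (t <= q)%N by rewrite max_card.
apply: le_trans (_ : \sum_(w in candidates s g)
   (u%:R / q%:R * (1 - alpha) + rho ^+ m) ^+ (n - m) <= _).
  by apply: ler_sum => w; apply: prob_candidate_le.
rewrite sumr_const -[leLHS]mulr_natl.
have b0 : 0 <= u%:R / q%:R * (1 - alpha) + rho ^+ m.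
  by rewrite addr_ge0 ?exprn_ge0 // mulr_ge0 // divr_ge0.
have b1 : 0 <= u%:R * (q%:R^-1 * (1 - alpha)) + rho ^+ m by rewrite mulrA.
apply: le_trans (_ : (q ^ (d * m) * t ^ n)%:R *
  (u%:R / q%:R * (1 - alpha) + rho ^+ m) ^+ (n - m) <= _).
  by rewrite ler_wpM2r ?exprn_ge0 // ler_nat card_candidates.
(* Split t^n as t^m t^(n - m). Multiplied into the base of the last power, t turns u / q into 1
   because u t = q, and t rho^m is at most q rho^m. *)
rewrite -{1}(subnKC m_le) expnD natrM natrM !natrX /B0 -!mulrA.
rewrite ler_wpM2l ?exprn_ge0 // -exprMn ler_pM ?exprn_ge0 ?mulr_ge0 //.
  by rewrite lerXn2r ?nnegrE // ler_nat.
have c0 : 0 <= 1 - alpha + q%:R * rho ^+ m by rewrite addr_ge0 // mulr_ge0 ?exprn_ge0.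
rewrite lerXn2r ?nnegrE ?mulr_ge0 // mulrDr lerD //.
  by rewrite !mulrA [t%:R * u%:R]mulrC -qE divff ?mul1r // gt_eqF.
by rewrite ler_wpM2r ?exprn_ge0 // ler_nat.
Qed.

(** * Adding the columns one at a time *)

Lemma kercol_submod k M : submod_closed (kercol k M).
Proof.
split=> [|a u v]; rewrite !inE; first by
  apply/forallP => j; rewrite mxE mulr0 -(scale0r 0) dotpZ mul0r eqxx implybT.
move=> /forallP Hu /forallP Hv; apply/forallP => j; apply/implyP => jk.
have /implyP/(_ jk)/eqP uj := Hu j; have /implyP/(_ jk)/eqP vj := Hv j.
by rewrite dotpD dotpZ !mxE uj vj mulrDr [a * (lam * _)]mulrCA.
Qed.

Lemma kercol_upd k M (j : 'I_n) x : (k <= j)%N -> kercol k (upd M j x) = kercol k M.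
Proof.
move=> kj; apply/setP => w; rewrite !inE; apply: eq_forallb => i.
case: (ltnP i k) => //= ik; rewrite upd_other //.
by rewrite neq_ltn (leq_trans ik kj).
Qed.

Definition colform (j : 'I_n) M w : F := dotp w (M j) - lam * w 0 j.

Lemma colform_lin j M a u v :
  colform j M (a *: u + v) = a * colform j M u + colform j M v.
Proof. by rewrite /colform dotpD dotpZ !mxE; ring. Qed.

Lemma kercolS (j : 'I_n) M :
  kercol j.+1 M = [set w in kercol j M | colform j M w == 0].
Proof.
apply/setP => w; rewrite !inE; apply/forallP/andP => [H|[/forallP H wj] i].
  split; last by have := H j; rewrite ltnS leqnn /= -subr_eq0.
  by apply/forallP => i; apply/implyP => ij; have := H i; rewrite ltnS (ltnW ij).
rewrite ltnS leq_eqVlt; case: (eqVneq (i : nat) j) => [/val_inj ->|_] /=.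
  by rewrite -subr_eq0.
exact: H.
Qed.

Definition dependent (j : 'I_n) M :=
  [forall w in kercol j M, dotp w (M j) == lam * w 0 j].

Lemma card_kercolS (j : 'I_n) M :
  #|kercol j M| = (#|kercol j.+1 M| * (if dependent j M then 1 else q))%N.
Proof.
rewrite kercolS (card_hyperplane (kercol_submod j M) (colform_lin j M)).
congr (_ * (if _ then _ else _))%N.
by apply: eq_forallb => w; rewrite /colform subr_eq0.
Qed.

Let q_gt0 : (0 < q)%N.
Proof. by rewrite ltnW // card_finRing_gt1. Qed.

Lemma card_kercol_ge k M : (k <= n)%N -> (q ^ n <= #|kercol k M| * q ^ k)%N.
Proof.
elim: k => [_|k IH kn].
  rewrite muln1 (_ : kercol 0 M = [set: _]) ?cardsT ?card_mx ?mul1n //.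
  by apply/setP => w; rewrite !inE; apply/forallP.
apply: leq_trans (IH (ltnW kn)) _; rewrite (card_kercolS (Ordinal kn)) /=.
rewrite expnS mulnA leq_pmul2r ?expn_gt0 ?q_gt0 // leq_pmul2l.
  by case: ifP => _ //; rewrite q_gt0.
by apply/card_gt0P; exists 0; case: (kercol_submod k.+1 M).
Qed.

(** Linear independence of the first k columns of M - lam, read off from the size q^(n - k) of their
    left kernel. *)
Definition indep k M := (#|kercol k M| * q ^ k == q ^ n)%N.

Lemma indepS (j : 'I_n) M : indep j.+1 M = indep j M && ~~ dependent j M.
Proof.
rewrite /indep; have := card_kercolS j M.
case: (boolP (dependent j M)) => _ cardK; last by rewrite cardK andbT expnS mulnA.
rewrite andbF; apply/negbTE; rewrite neq_ltn; apply/orP; right.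
apply: leq_ltn_trans (card_kercol_ge M (ltnW (ltn_ord j))) _.
rewrite cardK muln1 expnS mulnCA ltn_Pmull ?card_finRing_gt1 //.
rewrite muln_gt0 expn_gt0 q_gt0 andbT.
by apply/card_gt0P; exists 0; case: (kercol_submod j.+1 M).
Qed.

(** The kernel is stable under F, so a nonzero discrepancy can be scaled by some a to be seen by
    e. *)
Lemma solves_kercol k (j : 'I_n) M (x : V) :
  solves e id (fun w => lam * w 0 j) (kercol k M) x =
  [forall w in kercol k M, dotp w x == lam * w 0 j].
Proof.
have [K0 KZ] := kercol_submod k M.
apply/forall_inP/forall_inP => [H w wK|H w wK]; last first.
  by rewrite (eqP (H w wK)) subrr (character0 p_pr eD e_p).
rewrite -subr_eq0; apply: contraT => /(e_nt_mul e_nt)[a].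
have awK : a *: w \in kercol k M by rewrite -[_ *: w]addr0 KZ.
by have := H _ awK; rewrite dotpZ !mxE mulrCA -mulrBr => /eqP ->; rewrite eqxx.
Qed.

(** This is [solves_approx] with the kernel for H and {0} for S. The kernel is contained in that of
    the first n - m columns, so for good M its nonzero elements have supports of more than m
    elements. *)
Lemma prob_dependent_approx (j : 'I_n) M : indep j M -> ~~ bad M ->
  (n - m <= j)%N ->
  `|PV (fun x => [forall w in kercol j M, dotp w x == lam * w 0 j]%:R)
    - q%:R ^- (n - j)| <= rho ^+ m.
Proof.
move=> Ej Mgood jm.
have [K0 KZ] := kercol_submod j M.
have Kz : zmod_closed (kercol j M).
  by split=> // u v uK vK; rewrite -(addrC (- v)) -scaleN1r KZ.
have z0 : zmod_closed [set (0 : 'rV[F]_n)].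
  by split=> [|u v]; rewrite !inE // => /eqP -> /eqP ->; rewrite subrr.
have sub0 : [set (0 : 'rV[F]_n)] \subset kercol j M by rewrite finset.sub1set.
have dense : {in kercol j M :\: [set 0], forall w, (m <= #|supp e (id w)|)%N}.
  move=> w; rewrite !inE => /andP[w0 /forallP wK]; rewrite ltnW // ltnNge.
  apply: contra Mgood => wm; apply/exists_inP; exists w; last by rewrite w0.
  rewrite inE; apply/forallP => i; apply/implyP => ij.
  by have /implyP := wK i; apply; apply: leq_trans ij jm.
have idD : {morph id : a b / a + b :> 'rV[F]_n} by [].
have cD : {morph (fun w : 'rV[F]_n => lam * w 0 j) : a b / a + b}.
  by move=> a b; rewrite mxE mulrDr.
have := solves_approx p_pr mu_ge0 mu_sum1 mu_le rho01 rho_sq eD e_p idD cD Kz z0 sub0 dense.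
under eq_pexp => x do rewrite solves_kercol.
have -> : PV (fun x => (solves e id (fun w => lam * w 0 j) [set 0] x)%:R) = 1.
  rewrite -[RHS](pexp_cst 'I_n mu_sum1 1); apply: eq_pexp => x.
  rewrite (_ : solves _ _ _ _ _ = true) //; apply/forall_inP => w; rewrite inE => /eqP ->.
  by rewrite mxE mulr0 -(scale0r 0) dotpZ mul0r subrr (character0 p_pr eD e_p).
rewrite mulr1 cards1.
have -> : #|kercol j M| = (q ^ (n - j))%N.
  apply/eqP; rewrite -(eqn_pmul2r (_ : 0 < q ^ j)%N) ?expn_gt0 ?q_gt0 //.
  by rewrite -expnD subnK // ltnW.
by rewrite natrX div1r.
Qed.

Definition step_error : C := (1 - alpha) ^+ m *+ 2 + rho ^+ m + bad_bound *+ 2.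

(** The p masses sum to 1 and each is at most 1 - alpha, so 1/p <= 1 - alpha; and q >= p. *)
Lemma inv_card_le : q%:R^-1 <= 1 - alpha.
Proof.
have p0 : 0 < p%:R :> C by rewrite ltr0n prime_gt0.
apply: le_trans (_ : p%:R^-1 <= _).
  rewrite lef_pV2 ?posrE ?ltr0n ?q_gt0 ?prime_gt0 // ler_nat cardF.
  have d0 : (0 < d)%N.
    by move: (card_finRing_gt1 F); rewrite cardF; case: (d).
  by case: (d) d0 => // d' _; rewrite expnS leq_pmulr ?expn_gt0 ?prime_gt0.
rewrite -div1r ler_pdivrMr // -[leLHS]mu_sum1.
apply: le_trans (ler_sum _ (fun k _ => mu_le k)) _.
by rewrite sumr_const card_Fp // mulr_natr.
Qed.

(** For j < n - m both quantities are at most (1 - alpha)^m, by [odlyzko] and [inv_card_le].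
    Afterwards a bad M gets the trivial bound 2 and a good one [prob_dependent_approx]. *)
Lemma prob_dependent_error (j : 'I_n) M : indep j M ->
  `|PV (fun x => [forall w in kercol j M, dotp w x == lam * w 0 j]%:R)
    - q%:R ^- (n - j)| <= (1 - alpha) ^+ m *+ 2 + rho ^+ m + (bad M)%:R *+ 2.
Proof.
have [rho0 _] := andP rho01; have a0 := one_sub_alpha_ge0 mu_ge0 mu_le.
have q0 : 0 < q%:R :> C by rewrite ltr0n.
move=> Ej; set X := PV _; set Y := q%:R ^- _.
have X0 : 0 <= X by apply: pexp_ge0 => // x; rewrite ler0n.
have Y0 : 0 <= Y by rewrite invr_ge0 exprn_ge0.
have XY : `|X - Y| <= X + Y.
  by apply: le_trans (ler_normB _ _) _; rewrite !ger0_norm.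
have [jm|jm] := ltnP j (n - m).
  apply: le_trans XY _; rewrite -addrA ler_wpDr ?addr_ge0 ?exprn_ge0 ?mulrn_wge0 //.
  have mj : (m <= n - j)%N.
    move: jm; rewrite ltn_subRL => jm.
    by rewrite leq_subRL ?(ltnW (ltn_ord j)) // addnC ltnW.
  have a1 : 1 - alpha <= 1.
    by rewrite gerBl.
  rewrite mulr2n lerD //.
    apply: le_trans (odlyzko p_pr pF mu_ge0 mu_sum1 mu_le _ (r := n - j) (kercol_submod j M) _) _.
      rewrite -(leq_pmul2r (_ : 0 < q ^ j)%N) ?expn_gt0 ?q_gt0 //.
      by rewrite -expnD subnK ?card_kercol_ge // ltnW.
    by rewrite ler_wiXn2l.
  apply: le_trans (_ : (1 - alpha) ^+ (n - j) <= _).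
    by rewrite /Y -exprVn lerXn2r ?nnegrE ?invr_ge0 ?ler0n ?inv_card_le.
  by rewrite ler_wiXn2l.
have [Mbad|Mgood] := boolP (bad M).
  rewrite ler_wpDl ?addr_ge0 ?exprn_ge0 ?mulrn_wge0 ?exprn_ge0 //.
  apply: le_trans XY _; rewrite mulr2n lerD ?pexpV_le1 //.
  by rewrite /Y invf_le1 ?exprn_gt0 // exprn_ege1 // ler1n q_gt0.
apply: le_trans (prob_dependent_approx Ej Mgood jm) _.
by rewrite mul0rn addr0 lerDr mulrn_wge0 ?exprn_ge0.
Qed.

Definition prob_indep k : C := PM (fun M => (indep k M)%:R).

(* Column j of M is resampled independently of kercol j M. *)
Lemma prob_indepS (j : 'I_n) :
  `|prob_indep j.+1 - prob_indep j * (1 - q%:R ^- (n - j))| <= step_error.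
Proof.
pose g M (x : V) := [forall w in kercol j M, dotp w x == lam * w 0 j].
have dep_upd M x : dependent j (upd M j x) = g M x.
  by rewrite /dependent /g kercol_upd // upd_same.
have indep_upd M x : indep j (upd M j x) = indep j M.
  by rewrite /indep kercol_upd.
have -> : prob_indep j.+1 - prob_indep j * (1 - q%:R ^- (n - j)) =
    - PM (fun M => (indep j M)%:R * (PV (fun x => (g M x)%:R) - q%:R ^- (n - j))).
  have -> : prob_indep j.+1 = prob_indep j - PM (fun M => (indep j M && dependent j M)%:R).
    rewrite -pexpB; apply: eq_pexp => M; rewrite indepS.
    by case: (indep j M); case: (dependent j M); rewrite ?subr0 ?subrr.
  rewrite [X in _ - X - _](resample prodV_sum1 j).
  have -> : PM (fun M => \sum_x prodV x *
      (indep j (upd M j x) && dependent j (upd M j x))%:R) =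
      PM (fun M => (indep j M)%:R * PV (fun x => (g M x)%:R)).
    apply: eq_pexp => M; rewrite -pexpZ; apply: eq_bigr => x _.
    by rewrite dep_upd indep_upd -natrM mulnb.
  have -> : PM (fun M => (indep j M)%:R * (PV (fun x => (g M x)%:R) - q%:R ^- (n - j)))
    = PM (fun M => (indep j M)%:R * PV (fun x => (g M x)%:R)
        - q%:R ^- (n - j) * (indep j M)%:R).
    by apply: eq_pexp => M; rewrite mulrBr [_ * _^-1]mulrC.
  by rewrite pexpB pexpZ -/(prob_indep j); ring.
rewrite normrN; apply: le_trans (ler_norm_pexp prodV_ge0 _) _.
apply: le_trans (_ : PM (fun M => (1 - alpha) ^+ m *+ 2 + rho ^+ m + 2 * (bad M)%:R) <= _).
  apply: ler_pexp => [|M]; first exact: prodV_ge0.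
  rewrite normrM normr_nat mulr_natl.
  have [Ej|_] := boolP (indep j M).
    by rewrite mulr1n mul1r prob_dependent_error.
  have [rho0 _] := andP rho01; have a0 := one_sub_alpha_ge0 mu_ge0 mu_le.
  by rewrite mulr0n mul0r !addr_ge0 ?mulrn_wge0 ?exprn_ge0 // mulr_ge0.
rewrite pexpD pexp_cst ?prodV_sum1 // pexpZ lerD2l mulr_natl lerMn2r.
by rewrite prob_bad_le orbT.
Qed.

(** The step errors add up: the factors 1 - q^-(n - j) lie in [0, 1] and do not amplify earlier
    errors. *)
Lemma prob_indep_approx k : (k <= n)%N ->
  `|prob_indep k - \prod_(j < k) (1 - q%:R ^- (n - j))| <= k%:R * step_error.
Proof.
elim: k => [_|k IH kn].
  rewrite big_ord0 mul0r /prob_indep (eq_pexp _ (G' := fun=> 1)) => [|M].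
    by rewrite pexp_cst ?prodV_sum1 // subrr normr0.
  rewrite /indep muln1 (_ : kercol 0 M = [set: _]) ?cardsT ?card_mx ?mul1n ?eqxx //.
  by apply/setP => w; rewrite !inE; apply/forallP.
rewrite big_ord_recr /=; set P := \prod_(i < k) _; set u := 1 - _.
have -> : prob_indep k.+1 - P * u =
  (prob_indep k.+1 - prob_indep k * u) + (prob_indep k - P) * u by ring.
have -> : k.+1%:R * step_error = k%:R * step_error + step_error.
  by rewrite -natr1 mulrDl mul1r.
apply: le_trans (ler_normD _ _) _; rewrite addrC lerD //.
  rewrite normrM -[leRHS]mulr1 ler_pM ?normr_ge0 ?IH // 1?ltnW //.
  have q0 : 0 < q%:R :> C by rewrite ltr0n.
  have u1 : q%:R ^- (n - k) <= 1 :> C.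
    by rewrite invf_le1 ?exprn_gt0 // exprn_ege1 // ler1n.
  rewrite ger0_norm ?subr_ge0 // gerBl invr_ge0 exprn_ge0 // ltW //.
exact: (prob_indepS (Ordinal kn)).
Qed.

End Kernels.

(** * Reduction to the determinant over the extension field *)

Lemma irreducible_root_field (p : nat) (phi : {poly 'F_p}) :
  prime p -> irreducible_poly phi ->
  exists (F : finFieldType) (iota : {rmorphism 'F_p -> F}) (lam : F) (tau : F -> 'F_p),
  [/\ #|F| = (p ^ (size phi).-1)%N, root (map_poly iota phi) lam,
    (forall S : {set F}, zmod_closed S -> 1 \in S ->
      (forall a, a \in S -> lam * a \in S) -> S = [set: F]),
    {morph tau : a b / a + b} & exists b, tau b != 0].
Proof.
move=> p_pr phi_irr; have [L dimL [z phiz genz]] := irredp_FAdjoin phi_irr.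
pose F := finvect_type L.
have F0 : (0 < \dim {:L})%N by exact: adim_gt0.
(* [tau] is the first coordinate in a basis of L over ['F_p], hence nonzero on the first basis
   vector. *)
exists F, (in_alg L), z, (coord (vbasis {:L}) (Ordinal F0)); split => //.
- rewrite -(card_vspacef (Vector.class (F : vectType 'F_p))) card_vspace.
  by rewrite card_Fp // -dimL.
- move=> S [S0 SB] S1 Sz.
  have SD a b : a \in S -> b \in S -> a + b \in S.
    by move=> aS bS; rewrite -[b]opprK SB // -sub0r SB.
  have SM a k : a \in S -> a *+ k \in S.
    by move=> aS; elim: k => [|k IH]; rewrite ?mulr0n // mulrS SD.
  have zS k : z ^+ k \in S.
    by elim: k => [|k IH]; rewrite ?expr0 // exprS Sz.
  apply/setP => x; rewrite inE; have : (x : L) \in <<1; z>>%VS by rewrite genz memvf.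
  move=> /Fadjoin_polyP[f /polyOverP f1 ->]; rewrite horner_coef.
  elim/big_ind: _ => // i _; have /vlineP[k ->] := f1 i.
  by rewrite -scalerAl mul1r -[k]natr_Zp scaler_nat SM.
- by move=> a b; rewrite linearD.
- exists ((vbasis {:L})`_(Ordinal F0)); rewrite coord_free ?eqxx ?oner_neq0 //.
  exact: basis_free (vbasisP _).
Qed.

(** A root of 1 + X + ... + X^(p - 1) is a p-th root of unity, and it differs from 1 because p != 0
    in C. *)
Lemma exists_unity_neq1 (C : numClosedFieldType) (p : nat) : prime p ->
  exists2 z : C, z ^+ p = 1 & z != 1.
Proof.
move=> p_pr; have p1 : (0 < p.-1)%N by rewrite -ltnS prednK ?prime_gt1 ?prime_gt0.
have [z] := solve_monicpoly (fun=> -1 : C) p1; rewrite -mulr_sumr mulN1r => zE.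
have S0 : \sum_(i < p) z ^+ i = 0.
  by rewrite -(prednK (prime_gt0 p_pr)) big_ord_recr /= zE subrr.
exists z; first by apply/eqP; rewrite -subr_eq0 subrX1 S0 mulr0.
apply: contra_eq_neq S0 => ->; under eq_bigr => i _ do rewrite expr1n.
by rewrite sumr_const card_ord pnatr_eq0 -lt0n prime_gt0.
Qed.

Lemma exists_additive_character (C : numClosedFieldType) (p : nat) (F : finFieldType)
    (tau : F -> 'F_p) :
  prime p -> {morph tau : a b / a + b} -> (exists b, tau b != 0) ->
  exists e : F -> C, [/\ {morph e : a b / a + b >-> a * b},
    (forall a, e a ^+ p = 1) & exists b, e b != 1].
Proof.
move=> p_pr tauD [b tb]; have [z zp z1] := exists_unity_neq1 C p_pr.
exists (fun a => z ^+ tau a); split => [x y|a|].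
- rewrite tauD -exprD -[in RHS](expr_mod _ zp) /=.
  by congr (_ ^+ (_ %% _)); rewrite Fp_cast.
- by rewrite exprAC zp expr1n.
- exists b; apply: contra tb => /eqP zb; apply/eqP.
  by apply: (unity_exp_inj p_pr zp z1); rewrite zb.
Qed.

(** If phi does not divide g, the two are coprime, and remain so over K, which excludes a common
    root. *)
Lemma irreducible_dvd_root (k K : fieldType) (iota : {rmorphism k -> K})
    (phi g : {poly k}) (lam : K) :
  irreducible_poly phi -> root (map_poly iota phi) lam ->
  (phi %| g) = root (map_poly iota g) lam.
Proof.
move=> phi_irr phi_lam; apply/idP/idP => [phig|].
  have /dvdpP[h ->] : map_poly iota phi %| map_poly iota g by rewrite dvdp_map.
  by rewrite rootM phi_lam orbT.
apply: contraTT; rewrite -irreducible_poly_coprime // -(coprimep_map iota).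
by move=> /coprimep_root/(_ phi_lam).
Qed.

Section Determinant.

Variables (p n : nat) (F : finFieldType) (iota : {rmorphism 'F_p -> F}) (lam : F).
Hypothesis p_pr : prime p.

Local Notation V := {ffun 'I_n -> 'F_p}.

Definition mx_of_cols (M : {ffun 'I_n -> V}) : 'M['F_p]_n := \matrix_(i, j) M j i.

Lemma det_subX_root (A : 'M['F_p]_n) :
  root (map_poly iota (det_subX A)) lam = (\det (map_mx iota A - lam%:M) == 0).
Proof.
rewrite /root /det_subX -det_map_mx.
rewrite -[X in X == 0]/(horner_eval lam _) -det_map_mx.
congr (\det _ == 0); apply/matrixP => i j; rewrite !mxE.
rewrite rmorphB /= map_polyC rmorphMn /= map_polyX.
by rewrite /horner_eval !hornerE hornerMn hornerX.
Qed.

Lemma Fp_morphE k : iota k = (k : nat)%:R.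
Proof. by rewrite -{1}[k]natr_Zp rmorph_nat. Qed.

Lemma indep_det (M : {ffun 'I_n -> V}) :
  indep lam n M = (\det (map_mx iota (mx_of_cols M) - lam%:M) != 0).
Proof.
have q0 : (0 < #|F|)%N by rewrite ltnW // card_finRing_gt1.
have kerE (w : 'rV[F]_n) : (w \in kercol lam n M) =
    (w *m (map_mx iota (mx_of_cols M) - lam%:M) == 0).
  rewrite mulmxBr subr_eq0 mul_mx_scalar inE.
  apply/forallP/eqP => [H|H j].
    apply/rowP => j; have := H j; rewrite ltn_ord /= => /eqP wj.
    rewrite !mxE -wj; apply: eq_bigr => i _.
    by rewrite !mxE Fp_morphE mulr_natr.
  apply/implyP => _; apply/eqP; have := congr1 (fun u : 'rV_n => u 0 j) H.
  rewrite /= !mxE => <-; apply: eq_bigr => i _.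
  by rewrite !mxE Fp_morphE mulr_natr.
rewrite /indep -{2}(mul1n (#|F| ^ n)%N) eqn_pmul2r ?expn_gt0 ?q0 //.
apply/idP/idP => [/cards1P[w0 Kw0]|detN0].
  apply/negP => /det0P[v v0]; move/eqP; rewrite -kerE => vK.
  have : 0 \in kercol lam n M by rewrite kerE mul0mx.
  move: vK v0; rewrite Kw0 !inE => /eqP -> /negbTE.
  by rewrite eq_sym => ->.
apply/cards1P; exists 0; apply/setP => w; rewrite inE kerE.
apply/idP/eqP => [wN|->]; last by rewrite mul0mx.
apply/eqP; apply: contraNT detN0 => w0; apply/det0P.
by exists w => //; apply/eqP.
Qed.

End Determinant.

(** The real form of [n%:R * step_error] for q = p^d. *)
Definition total_error (R : rcfType) (p n d m : nat) (alpha rho : R) : R :=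
  let q := (p ^ d)%:R in
  n%:R * ((1 - alpha) ^+ m *+ 2 + rho ^+ m
    + q ^+ d * n%:R ^+ (d * m) * q ^+ (d * m) * q ^+ m
        * (1 - alpha + q * rho ^+ m) ^+ (n - m) *+ 2).

(** * Divisibility of the characteristic polynomial for a real law of the entries *)

Section CharPolyProbability.

Variables (R : rcfType) (p n m : nat) (mu : 'F_p -> R) (alpha rho : R).
Variable phi : {poly 'F_p}.
Hypotheses (p_pr : prime p) (phi_irr : irreducible_poly phi).
Hypotheses (mu_ge0 : forall k, 0 <= mu k) (mu_sum1 : \sum_k mu k = 1).
Hypotheses (alpha_ge0 : 0 <= alpha) (mu_le : forall k, mu k <= 1 - alpha).
Hypotheses (rho01 : 0 <= rho <= 1) (rho_sq : 1 - 2 * alpha / p%:R ^+ 2 <= rho ^+ 2).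
Hypotheses (m_gt0 : (0 < m)%N) (m_le : (m <= n)%N).

Local Notation d := (deg phi).
Local Notation toC := (real_complex R).

Definition prob_mx (Q : pred 'M['F_p]_n) : R :=
  \sum_(A : 'M['F_p]_n | Q A) \prod_(ij : 'I_n * 'I_n) mu (A ij.1 ij.2).

Lemma prob_mx_predC (Q : pred 'M['F_p]_n) :
  prob_mx (predC Q) = pexp (prodw mu) (fun M => (~~ Q (mx_of_cols M))%:R).
Proof.
have bij_cols : bijective (@mx_of_cols p n).
  exists (fun A : 'M['F_p]_n => [ffun j => [ffun i => A i j]]) => [M|A].
    by apply/ffunP => j; apply/ffunP => i; rewrite !ffunE mxE.
  by apply/matrixP => i j; rewrite mxE !ffunE.
rewrite /prob_mx (reindex _ (onW_bij _ bij_cols)) big_mkcond /=.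
apply: eq_bigr => M _; case: (Q _); rewrite ?mulr0 ?mulr1 //.
rewrite -(pair_bigA _ (fun i j => mu (mx_of_cols M i j))) exchange_big /=.
by apply: eq_bigr => j _; apply: eq_bigr => i _; rewrite mxE.
Qed.

Lemma prob_mx_total : prob_mx predT = 1.
Proof.
transitivity (prob_mx (predC pred0)); first exact: eq_bigl.
rewrite prob_mx_predC; apply: pexp_cst; exact: prodw_sum1.
Qed.

(** phi divides det(M - x) iff lam is a root, that is, iff the n columns of M - lam are dependent.
    The characters require complex numbers, but both sides of [prob_indep_approx] come from R, and
    the inequality is pulled back along [toC]. *)
Lemma prob_charpoly_approx :
  `|prob_mx (fun A => phi %| det_subX A)
    - (1 - \prod_(1 <= i < n.+1) (1 - p%:R ^- (i * d)))| <= total_error p n d m alpha rho.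
Proof.
have [F [iota [lam [tau [cardF phi_lam lam_gen tauD tau_nt]]]]] :=
  irreducible_root_field p_pr phi_irr.
have [e [eD e_p e_nt]] := exists_additive_character R[i] p_pr tauD tau_nt.
have pF : p \in [pchar F].
  by rewrite (fmorph_pchar iota) pchar_Fp.
have lec a b : (toC a <= toC b) = (a <= b) by exact: lecR.
have mu'_ge0 k : 0 <= toC (mu k) by rewrite -[0]/(toC 0) lec.
have mu'_sum1 : \sum_k toC (mu k) = 1 by rewrite -rmorph_sum mu_sum1.
have mu'_le k : toC (mu k) <= 1 - toC alpha by rewrite -(rmorph1 toC) -rmorphB lec.
have alpha'_ge0 : 0 <= toC alpha by rewrite -[0]/(toC 0) lec.
have rho'01 : 0 <= toC rho <= 1.
  by rewrite -[0]/(toC 0) -[1]/(toC 1) !lec.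
have rho'_sq : 1 - 2 * toC alpha / p%:R ^+ 2 <= toC rho ^+ 2.
  have -> : 1 - 2 * toC alpha / p%:R ^+ 2 = toC (1 - 2 * alpha / p%:R ^+ 2).
    by rewrite rmorphB rmorph1 !rmorphM /= fmorphV rmorphXn /= !rmorph_nat.
  have -> : toC rho ^+ 2 = toC (rho ^+ 2) by rewrite rmorphXn.
  by rewrite lec.
have := prob_indep_approx p_pr pF mu'_ge0 mu'_sum1 alpha'_ge0 mu'_le rho'01 rho'_sq
  eD e_p e_nt lam_gen cardF m_gt0 m_le (leqnn n).
have -> : n%:R * step_error (toC alpha) (toC rho) F n m (size phi).-1 = toC (total_error p n d m alpha rho).
  rewrite /step_error /bad_bound /total_error cardF /deg.
  rewrite !(rmorphM toC, rmorphD toC, rmorphXn toC, rmorphN toC, rmorphMn toC, rmorph1 toC).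
  by [].
have -> : prob_indep (fun k => toC (mu k)) lam n n =
    toC (1 - prob_mx (fun A => phi %| det_subX A)).
  rewrite -prob_mx_total /prob_mx [X in toC (X - _)](bigID (fun A => phi %| det_subX A)) /=.
  rewrite addrAC subrr add0r -/(prob_mx (predC (fun A => phi %| det_subX A))).
  rewrite prob_mx_predC rmorph_sum; apply: eq_bigr => M _.
  rewrite rmorphM rmorph_nat /= (indep_det iota) -(det_subX_root iota lam).
  rewrite -(irreducible_dvd_root _ phi_irr phi_lam); congr (_ * _).
  by rewrite rmorph_prod; apply: eq_bigr => j _; rewrite rmorph_prod.
have -> : \prod_(j < n) (1 - #|F|%:R ^- (n - j)) =
    toC (\prod_(1 <= i < n.+1) (1 - p%:R ^- (i * d))).
  rewrite rmorph_prod big_nat_rev big_add1 big_mkord /=; apply: eq_bigr => j _.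
  rewrite rmorphB rmorph1 fmorphV rmorphXn rmorph_nat cardF natrX -exprM mulnC.
  by rewrite add1n !subSS.
rewrite -rmorphB normc_def /= expr0n addr0 sqrtr_sqr lec => H.
apply: le_trans H; rewrite -normrN le_eqVlt; apply/orP; left; apply/eqP.
by congr (`|_|); ring.
Qed.

End CharPolyProbability.

(** * Asymptotics of the error *)

Section ErrorAsymptotics.

Variables (R : realType) (n p d D m : nat) (alpha b W s : R).
Hypotheses (alpha01 : 0 < alpha < 1) (p_gt1 : (1 < p)%N) (d_range : (0 < d <= D)%N).
Hypotheses (m_gt0 : (0 < m)%N) (ps : p%:R ^+ 2 <= s) (n_eq : n%:R = s * W ^+ 4).
Hypotheses (b_gt0 : 0 < b) (ln_n : ln n%:R <= b * W).
Hypotheses (m_upper : m%:R <= s * W ^+ 2) (m_lower : s * W ^+ 2 <= 2 * m%:R).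
Hypotheses (W2 : 2 <= W) (W_alpha : 8 <= alpha ^+ 2 * W).
Hypothesis W_b : 40 * b * D%:R ^+ 2 <= alpha * W.

(** X is the quantity n^(1 - eps) / p^2 of the final exponent and E the target for each error term.
    By 1 + x <= exp x, rho satisfies 1 - 2 alpha / p^2 <= rho^2. *)
Let X : R := s / p%:R ^+ 2.
Let rho : R := expR (- (alpha / p%:R ^+ 2)).
Let E : R := expR (- (alpha / 4 * X)).

Let alpha_gt0 : 0 < alpha. Proof. by case/andP: alpha01. Qed.

Let alpha_pos : 0 <= alpha. Proof. exact: ltW. Qed.

Let b_ge0 : 0 <= b. Proof. exact: ltW. Qed.

Let p_ge1 : 1 <= p%:R :> R. Proof. by rewrite ler1n ltnW. Qed.

Let u_ge1 : 1 <= p%:R ^+ 2 :> R. Proof. exact: exprn_ege1. Qed.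

Let s_ge1 : 1 <= s. Proof. exact: le_trans u_ge1 ps. Qed.

Let X_ge1 : 1 <= X. Proof. by rewrite ler_pdivlMr ?mul1r // (lt_le_trans ltr01). Qed.

Let X_le_s : X <= s.
Proof. by rewrite ler_pdivrMr ?(lt_le_trans ltr01) // ler_peMr // (le_trans ler01). Qed.

Let W_sq_ge4 : 4 <= W ^+ 2. Proof. have := W2; nra. Qed.

Let W_gt0 : 0 < W. Proof. exact: lt_le_trans W2. Qed.

Let W_ge0 : 0 <= W. Proof. exact: ltW. Qed.

Let s_gt0 : 0 < s. Proof. exact: lt_le_trans s_ge1. Qed.

Let s_ge0 : 0 <= s. Proof. exact: ltW. Qed.

Let X_ge0 : 0 <= X. Proof. exact: le_trans X_ge1. Qed.

Let Wsq_ge0 : 0 <= W ^+ 2. Proof. exact: sqr_ge0. Qed.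

Let s_le_n : s <= n%:R.
Proof.
rewrite n_eq ler_peMr // exprn_ege1 //.
by apply: le_trans W2; rewrite ler1n.
Qed.

Let n_gt0R : 0 < n%:R :> R. Proof. exact: lt_le_trans s_le_n. Qed.

Let n_gt0 : (0 < n)%N. Proof. by rewrite -(ltr0n R). Qed.

Let m_lt_n : 4 * m%:R <= n%:R :> R.
Proof.
rewrite n_eq; have : 4 * (s * W ^+ 2) <= s * W ^+ 4; last by have := m_upper; lra.
have -> : s * W ^+ 4 = (s * W ^+ 2) * W ^+ 2 by ring.
by rewrite mulrC ler_wpM2l // mulr_ge0.
Qed.

Let D_ge1 : 1 <= D%:R :> R.
Proof. by rewrite ler1n; case/andP: d_range => /leq_trans h /h. Qed.

Let D_ge0 : 0 <= D%:R :> R. Proof. exact: ler0n. Qed.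

Let nE : n%:R = expR (ln n%:R) :> R. Proof. by rewrite lnK // posrE. Qed.

Let ln_n_ge0 : 0 <= ln (n%:R : R).
Proof. by rewrite ln_ge0 // ler1n. Qed.

Let p_le_n : (p <= n)%N.
Proof.
rewrite -(ler_nat R); apply: le_trans s_le_n; apply: le_trans ps.
by rewrite expr2 ler_peMr // (le_trans ler01).
Qed.

Let m_div : X * W ^+ 2 / 2 <= m%:R / p%:R ^+ 2.
Proof.
have -> : X * W ^+ 2 / 2 = (s * W ^+ 2 / 2) / p%:R ^+ 2 by rewrite /X; ring.
by rewrite ler_pM2r ?invr_gt0 ?(lt_le_trans ltr01) //; have := m_lower; lra.
Qed.

Let rho_m : rho ^+ m = expR (- (alpha * (m%:R / p%:R ^+ 2))).
Proof. by rewrite -expRM_natl; congr expR; ring. Qed.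

Let alpha_m : (1 - alpha) ^+ m <= rho ^+ m.
Proof.
have a1 : 0 <= 1 - alpha by case/andP: alpha01; lra.
rewrite lerXn2r ?nnegrE ?expR_ge0 //.
apply: le_trans (expR_ge1Dx _) _; rewrite ler_expR lerN2.
by rewrite ler_pdivrMr ?(lt_le_trans ltr01) // ler_peMr.
Qed.

Let D_ln : D%:R * ln n%:R <= alpha * W ^+ 2 / 40.
Proof.
apply: le_trans (_ : D%:R * (b * W) <= _); first by rewrite ler_wpM2l // (le_trans ler01).
have : 40 * b * D%:R <= alpha * W.
  apply: le_trans W_b; rewrite ler_wpM2l //; first by rewrite mulr_ge0.
  by rewrite expr2 ler_peMr.
move/(ler_wpM2r W_ge0); lra.
Qed.

Let n_rho : n%:R * rho ^+ m <= E.
Proof.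
rewrite nE rho_m -expRD ler_expR.
have : ln n%:R <= alpha * W ^+ 2 / 40.
  by apply: le_trans D_ln; rewrite ler_peMl.
have := ler_wpM2l alpha_pos m_div.
(* For [lra] the products of alpha, X and W^2 are independent atoms; these inequalities relate
   them. *)
have : 0 <= alpha * ((X - 1) * (W ^+ 2 - 1)).
  by rewrite !mulr_ge0 ?subr_ge0 //; have := W_sq_ge4; lra.
have : 0 <= alpha * (X - 1) by rewrite mulr_ge0 ?subr_ge0.
have : 0 <= alpha * (W ^+ 2 - 1).
  by rewrite mulr_ge0 ?subr_ge0 //; have := W_sq_ge4; lra.
by have := alpha_gt0; lra.
Qed.

Let q_le : (p ^ d <= n ^ D)%N.
Proof.
case/andP: d_range => _ dD; apply: (@leq_trans (n ^ d)); first by rewrite leq_exp2r //; case/andP: d_range.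
by rewrite leq_pexp2l.
Qed.

(** q <= n^D, and D ln n takes only a small part of the exponent of rho^m. What remains is exp(-y)
    <= 1 / (1 + y) with y = alpha W^2 / 4, and alpha^2 W^2 >= 16. *)
Let q_rho : (p ^ d)%:R * rho ^+ m <= alpha / 2.
Proof.
apply: le_trans (_ : expR (- (alpha * W ^+ 2 / 4)) <= _).
  apply: le_trans (_ : (n ^ D)%:R * rho ^+ m <= _).
    by rewrite ler_wpM2r ?exprn_ge0 ?expR_ge0 // ler_nat.
  rewrite natrX nE -expRM_natl rho_m -expRD ler_expR.
  have := ler_wpM2l alpha_pos m_div.
  have : alpha * W ^+ 2 <= alpha * (X * W ^+ 2).
    by rewrite ler_wpM2l // ler_peMl.
  have := D_ln; have : 0 <= alpha * W ^+ 2 by rewrite mulr_ge0.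
  by lra.
rewrite expRN -[leLHS]mul1r ler_pdivrMr ?expR_gt0 //.
apply: le_trans (_ : alpha / 2 * (1 + alpha * W ^+ 2 / 4) <= _); last first.
  by rewrite ler_wpM2l ?expR_ge1Dx // divr_ge0.
have : 16 <= alpha ^+ 2 * W ^+ 2.
  have -> : alpha ^+ 2 * W ^+ 2 = (alpha ^+ 2 * W) * W by ring.
  by have := W_alpha; have := W2; nra.
have := alpha_gt0; nra.
Qed.

(** The counting factors amount to at most n^(5 D^2 m) <= exp(alpha n / 8) by [W_b]. The last power
    has base at most exp(-alpha / 2) and exponent n - m >= 3n/4, so exp(-alpha n / 4) is left, and X
    <= n. *)
Let n_bad : n%:R * ((p ^ d)%:R ^+ d * n%:R ^+ (d * m) * (p ^ d)%:R ^+ (d * m)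
  * (p ^ d)%:R ^+ m * (1 - alpha + (p ^ d)%:R * rho ^+ m) ^+ (n - m)) <= E.
Proof.
have [d0 dD] := andP d_range; have D0 : (0 < D)%N := leq_trans d0 dD.
pose k := (D * D * m)%N.
have pow_le i : (i <= k)%N -> (n ^ i <= n ^ k)%N by move=> ik; rewrite leq_pexp2l.
have qpow_le i : (D * i <= k)%N -> ((p ^ d) ^ i <= n ^ k)%N.
  move=> ik; apply: leq_trans (pow_le _ ik); rewrite expnM.
  by case: (i) => // i'; rewrite leq_exp2r.
have nat_le : (n * ((p ^ d) ^ d * n ^ (d * m) * (p ^ d) ^ (d * m) * (p ^ d) ^ m)
    <= n ^ (5 * k))%N.
  have -> : (5 * k = k + (k + k + k + k))%N by rewrite !mulSn addn0 !addnA.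
  rewrite !expnD; apply: leq_mul.
    by rewrite -{1}(expn1 n) pow_le // /k !muln_gt0 D0.
  apply: leq_mul; last by rewrite qpow_le // /k leq_mul2r leq_pmulr ?orbT.
  apply: leq_mul; last by rewrite qpow_le // /k -mulnA leq_mul2l leq_mul2r dD !orbT.
  apply: leq_mul; last by rewrite pow_le // /k leq_mul2r (leq_trans dD) ?leq_pmulr ?orbT.
  rewrite qpow_le // /k -mulnA leq_mul2l (leq_trans dD) ?orbT // leq_pmulr //.
have base0 : 0 <= 1 - alpha + (p ^ d)%:R * rho ^+ m.
  rewrite addr_ge0 ?mulr_ge0 ?exprn_ge0 ?expR_ge0 //.
  by case/andP: alpha01; lra.
have base_le : 1 - alpha + (p ^ d)%:R * rho ^+ m <= expR (- (alpha / 2)).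
  by apply: le_trans (expR_ge1Dx _); have := q_rho; lra.
have m_le_n : (m <= n)%N by rewrite -(ler_nat R); have := m_lt_n; have : 0 <= m%:R :> R by []; lra.
apply: le_trans (_ : (n ^ (5 * k))%:R * expR (- (alpha / 2)) ^+ (n - m) <= _).
  rewrite mulrA; apply: ler_pM; rewrite ?exprn_ge0 //.
    by rewrite -!natrX -!natrM ler_nat.
  by rewrite lerXn2r ?nnegrE ?expR_ge0.
rewrite natrX {1}nE -!expRM_natl -expRD ler_expR natrB // /k !natrM.
have mln : m%:R * ln n%:R <= s * W ^+ 2 * (b * W) by rewrite ler_pM.
have sW : 0 <= s * W ^+ 3 by rewrite mulr_ge0 ?exprn_ge0.
have main : 5 * (D%:R * D%:R * m%:R) * ln n%:R <= alpha / 8 * n%:R.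
  apply: le_trans (_ : 5 * (D%:R * D%:R) * (s * W ^+ 2 * (b * W)) <= _).
    rewrite [leLHS](_ : _ = 5 * (D%:R * D%:R) * (m%:R * ln n%:R)); last by ring.
    by rewrite ler_wpM2l // !mulr_ge0.
  have := ler_wpM2r sW W_b; rewrite n_eq.
  have -> : 40 * b * D%:R ^+ 2 * (s * W ^+ 3) =
     8 * (5 * (D%:R * D%:R) * (s * W ^+ 2 * (b * W))) by ring.
  have -> : alpha * W * (s * W ^+ 3) = 8 * (alpha / 8 * (s * W ^+ 4)) by field.
  by lra.
have am : alpha * (4 * m%:R) <= alpha * n%:R by rewrite ler_wpM2l.
have aX : alpha * X <= alpha * n%:R.
  by rewrite ler_wpM2l // (le_trans X_le_s).
by move: main am aX; lra.
Qed.

Let q_pow : (p ^ d)%:R ^- n <= E.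
Proof.
have h : (2^-1 : R) <= expR (- (1 / 2)) by apply: le_trans (expR_ge1Dx _); lra.
apply: le_trans (_ : (2^-1 : R) ^+ n <= _).
  rewrite -exprVn lerXn2r ?nnegrE ?invr_ge0 // lef_pV2 ?posrE ?ltr0n ?expn_gt0 ?(ltnW p_gt1) //.
  rewrite ler_nat; case/andP: d_range => d0 _.
  by case: (d) d0 => // d' _; rewrite expnS (leq_trans p_gt1) // leq_pmulr // expn_gt0 ltnW.
apply: le_trans (_ : expR (- (1 / 2)) ^+ n <= _); first by rewrite lerXn2r ?nnegrE ?expR_ge0 ?invr_ge0.
rewrite -expRM_natl ler_expR.
have aX : alpha * X <= n%:R.
  apply: le_trans (le_trans X_le_s s_le_n); rewrite ler_piMl //.
  by case/andP: alpha01 => _ /ltW.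
by have := n_gt0R; lra.
Qed.

(** Of the six E, two pay for (1 - alpha)^m, one for rho^m, two for bad matrices and one for
    q^-n. *)
Lemma total_error_le :
  total_error p n d m alpha (expR (- (alpha / p%:R ^+ 2))) + (p ^ d)%:R ^- n
    <= 6 * expR (- (alpha / 4 * (s / p%:R ^+ 2))).
Proof.
have n_alpha : n%:R * (1 - alpha) ^+ m <= E.
  by apply: le_trans n_rho; rewrite ler_wpM2l.
rewrite /total_error -/rho -/X -/E; move: n_alpha n_rho n_bad q_pow.
set a := (1 - alpha) ^+ m; set r := rho ^+ m; set B := _ ^+ d * _ * _ * _ * _.
by lra.
Qed.

End ErrorAsymptotics.

(* W = n ^ (eps / 4) and s = n ^ (1 - eps), hence n = s * W ^ 4, and the sparsity
   threshold is m = floor (s * W ^ 2). *)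
Lemma total_error_asymptotics (R : realType) (alpha eps : R) (D : nat) :
  0 < alpha < 1 -> 0 < eps < 1 -> exists n0 : R, forall n p d : nat,
  (1 < p)%N -> (0 < d <= D)%N -> p%:R <= n%:R `^ ((1 - eps) / 2) ->
  n0 <= n%:R -> exists2 m : nat, (0 < m <= n)%N &
  total_error p n d m alpha (expR (- (alpha / p%:R ^+ 2))) + (p ^ d)%:R ^- n
    <= 6 * expR (- (alpha / 4 * (n%:R `^ (1 - eps) / p%:R ^+ 2))).
Proof.
move=> alpha01 eps01; have [a0 a1] := andP alpha01; have [eps0 eps1] := andP eps01.
(* With W = n^(1 / b), ln n = b ln W <= b W. *)
pose b := 4 / eps; have b0 : 0 < b by rewrite divr_gt0.
(* W0 adds up the lower bounds on W behind [W2], [W_alpha] and [W_b]; W >= W0 amounts to n >=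
   W0^b. *)
pose W0 := 2 + 8 / alpha ^+ 2 + 40 * b * D%:R ^+ 2 / alpha.
have c1 : 0 <= 8 / alpha ^+ 2 by rewrite divr_ge0 ?sqr_ge0.
have c2 : 0 <= 40 * b * D%:R ^+ 2 / alpha.
  apply: divr_ge0; last exact: ltW.
  by apply: mulr_ge0; [apply: mulr_ge0; [|exact: ltW]|exact: sqr_ge0].
exists (W0 `^ b) => n p d p1 dD pn n0.
have n_gt0 : (0 < n)%N.
  rewrite lt0n; apply: contraTneq pn => ->; rewrite powR0; last by rewrite gt_eqF ?divr_gt0 ?subr_gt0.
  by rewrite -ltNge ltr0n ltnW.
have nR0 : 0 < n%:R :> R by rewrite ltr0n.
have n1 : 1 <= n%:R :> R by rewrite ler1n.
pose W := n%:R `^ (eps / 4) : R; pose s := n%:R `^ (1 - eps) : R.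
have powE k (r : R) : (n%:R `^ r) ^+ k = n%:R `^ (r * k%:R).
  by rewrite powRrM powR_mulrn ?powR_ge0.
have n_pow (r t : R) : n%:R `^ (r + t) = n%:R `^ r * n%:R `^ t.
  by rewrite powRD // (gt_eqF nR0) implybT.
have n_eq : n%:R = s * W ^+ 4.
  rewrite powE -n_pow (_ : 1 - eps + eps / 4 * 4 = 1) ?powRr1 //; by field.
have W_ge : W0 <= W.
  have W00 : 0 <= W0 by rewrite /W0; lra.
  rewrite -[W0]powRr1 // -(_ : b * (eps / 4) = 1); last first.
    by rewrite /b; field; rewrite gt_eqF.
  by rewrite powRrM ge0_ler_powR ?nnegrE ?powR_ge0 // ltW ?divr_gt0.
have W2 : 2 <= W by apply: le_trans W_ge; rewrite /W0; lra.
have W_alpha : 8 <= alpha ^+ 2 * W.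
  rewrite mulrC -ler_pdivrMr ?exprn_gt0 //; apply: le_trans W_ge.
  by rewrite /W0; lra.
have W_b : 40 * b * D%:R ^+ 2 <= alpha * W.
  by rewrite [leRHS]mulrC -ler_pdivrMr //; apply: le_trans W_ge; rewrite /W0; lra.
have W_gt0 : 0 < W by apply: lt_le_trans W2.
have ln_n : ln n%:R <= b * W.
  have lnW : ln W = eps / 4 * ln n%:R by rewrite ln_powR.
  have -> : ln n%:R = b * ln W by rewrite lnW /b; field; rewrite gt_eqF.
  by rewrite ler_wpM2l ?ltW // ln_sublinear.
have ps : p%:R ^+ 2 <= s.
  have -> : s = (n%:R `^ ((1 - eps) / 2)) ^+ 2 by rewrite powE; congr (_ `^ _); field.
  by rewrite lerXn2r ?nnegrE ?powR_ge0.
have s1 : 1 <= s.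
  by apply: le_trans ps; rewrite exprn_ege1 // ler1n ltnW.
have s0 : 0 <= s by apply: le_trans s1.
have y1 : 1 <= s * W ^+ 2.
  by rewrite -[leLHS]mulr1 ler_pM // exprn_ege1 // (le_trans _ W2) // ler1n.
have y0 : 0 <= s * W ^+ 2 by apply: le_trans y1.
pose m := Num.truncn (s * W ^+ 2).
have /andP[m_upper m_up] := truncn_itv y0.
have m0 : (0 < m)%N by rewrite truncn_gt0.
have m_lower : s * W ^+ 2 <= 2 * m%:R.
  apply: le_trans (ltW m_up) _; rewrite -natr1 mulr_natl mulr2n lerD2l.
  by rewrite ler1n.
exists m; last exact: (total_error_le alpha01 p1 dD m0 ps n_eq b0 ln_n m_upper m_lower W2 W_alpha W_b).
rewrite m0 /= -(ler_nat R); apply: le_trans m_upper _.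
by rewrite [leRHS]n_eq ler_wpM2l // ler_weXn2l // (le_trans _ W2) // ler1n.
Qed.

Local Open Scope classical_set_scope.
Local Open Scope ring_scope.

(** * From random variables to finite sums *)

(** The factor of index i lowers the partial product by at most x^i, and for x <= 1/2 the x^i with i
    > n sum to at most x^n. *)
Lemma infinite_prod_tail (R : realType) (x : R) (n : nat) : 0 <= x <= 2^-1 ->
  `|\prod_(1 <= i < n.+1) (1 - x ^+ i) - infinite_prod (fun i => 1 - x ^+ i)| <= x ^+ n.
Proof.
move=> /andP[x0 x2]; have x1 : x <= 1 by lra.
pose u i : R := 1 - x ^+ i; have u01 i : 0 <= u i <= 1.
  by rewrite /u subr_ge0 exprn_ile1 //= gerBl exprn_ge0.
pose v N := \prod_(1 <= i < N.+1) u i.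
have vS N : v N.+1 = v N * u N.+1 by rewrite /v big_nat_recr.
have v0 N : 0 <= v N by apply: prodr_ge0 => i _; case/andP: (u01 i).
have v_le1 N : v N <= 1.
  by apply: prodr_ile1 => i _.
have noninc : {homo v : N M / (N <= M)%N >-> M <= N}.
  by apply/nonincreasing_seqP => N; rewrite vS ler_piMr //; case/andP: (u01 N.+1).
have v_cvg : cvgn v by apply: cvgP; exact: cvg_infinite_prod.
(* The extra term x^(n + k) makes the induction close, through 2 x^(N + 1) <= x^N. *)
have lower k : v n - x ^+ n + x ^+ (n + k) <= v (n + k)%N.
  elim: k => [|k IH]; first by rewrite addn0 subrK.
  rewrite addnS vS [u _.+1]/u mulrBr mulr1.
  have h1 : v (n + k)%N * x ^+ (n + k).+1 <= x ^+ (n + k).+1.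
    by rewrite ler_piMl ?exprn_ge0.
  have h2 : 2 * x ^+ (n + k).+1 <= x ^+ (n + k).
    by rewrite exprS mulrA ler_piMl ?exprn_ge0 //; lra.
  by move: (x ^+ (n + k).+1) (x ^+ (n + k)) (v (n + k)%N) IH h1 h2 => a b' c'; lra.
have le_v : infinite_prod u <= v n by apply: nonincreasing_cvgn_ge.
have ge_v : v n - x ^+ n <= infinite_prod u.
  apply: limr_ge => //; exists n => // N /= nN.
  rewrite -(subnKC nN); apply: le_trans (lower _).
  by rewrite lerDl exprn_ge0.
by rewrite -/(v n) ger0_norm ?subr_ge0 // lerBlDr addrC -lerBlDr.
Qed.

Lemma infinite_prod_itv (R : realType) (u : nat -> R) :
  (forall i, 0 <= u i <= 1) -> 0 <= infinite_prod u <= 1.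
Proof.
move=> u01; pose v N := \prod_(1 <= i < N.+1) u i.
have v_cvg : cvgn v by apply: cvgP; exact: cvg_infinite_prod.
apply/andP; split.
  by apply: limr_ge => //; exists 0%N => // N _; apply: prodr_ge0 => i _; case/andP: (u01 i).
by apply: limr_le => //; exists 0%N => // N _; apply: prodr_ile1 => i _.
Qed.

Section FiniteRange.

Variables (R : realType) (d : measure_display) (T : measurableType d).
Variables (P : probability T R) (J : finType) (f : T -> J).
Hypothesis f_meas : forall j, measurable (f @^-1` [set j]).

Lemma measurable_finite_range (Q : pred J) : measurable [set w | Q (f w)].
Proof.
rewrite (_ : [set w | Q (f w)] = \bigcup_(j in [set` Q]) (f @^-1` [set j])).
  by apply: fin_bigcup_measurable => // ; exact: finite_finset.
by apply/seteqP; split => [w Qw|w [j Qj /= ->]] //; exists (f w).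
Qed.

Lemma probability_finite_range (Q : pred J) :
  P [set w | Q (f w)] = \sum_(j | Q j) P (f @^-1` [set j]).
Proof.
rewrite (_ : [set w | Q (f w)] = \bigcup_(j in [set` Q]) (f @^-1` [set j])).
  rewrite measure_fin_bigcup //; last first.
  - apply/trivIsetP => i j _ _ ij; apply/seteqP; split => // w [/= wi wj].
    by move: ij; rewrite -wi -wj eqxx.
  rewrite (fsbigE (enum Q)) ?enum_uniq //.
  - rewrite big_enum_cond /=; apply: eq_bigl => j.
    by apply/andP/idP => [[]//|Qj]; split=> //; rewrite inE.
  - by move=> j /=; rewrite mem_enum.
  - by move=> j Qj; rewrite mem_enum => /negP.
by apply/seteqP; split => [w Qw|w [j Qj /= ->]] //; exists (f w).
Qed.

End FiniteRange.

Section Reduction.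

Variables (R : realType) (p n : nat) (alpha : R).
Variables (d0 : measure_display) (T0 : measurableType d0) (P0 : probability T0 R).
Variables (xi : {RV P0 >-> 'F_p}) (d : measure_display) (T : measurableType d).
Variables (P : probability T R) (X : 'I_n * 'I_n -> {RV P >-> 'F_p}).
Hypotheses (xi_bal : balanced alpha xi) (X_iid : iid_copies X xi).

Definition law (a : 'F_p) : R := fine (P0 (xi @^-1` [set a])).

Let xi_meas a : measurable (xi @^-1` [set a]).
Proof. exact: measurable_funPTI. Qed.

Lemma lawE a : P0 (xi @^-1` [set a]) = (law a)%:E.
Proof. by rewrite fineK // fin_num_measure. Qed.

Lemma law_ge0 a : 0 <= law a.
Proof. exact: fine_ge0. Qed.

Lemma law_sum1 : \sum_a law a = 1.
Proof.
apply: EFin_inj; rewrite -sumEFin -(probability_setT P0).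
under eq_bigr => a _ do rewrite -lawE.
rewrite -(probability_finite_range P0 xi_meas predT); congr (P0 _).
by apply/seteqP; split.
Qed.

Lemma law_le a : law a <= 1 - alpha.
Proof.
rewrite -lee_fin -lawE; apply: le_trans xi_bal.
exact: (le_bigmax _ (fun a => P0 (xi @^-1` [set a])) a).
Qed.

Lemma random_mx_preimage (A : 'M['F_p]_n) : random_mx X @^-1` [set A] =
  \bigcap_(ij in [set` [set: 'I_n * 'I_n]%SET]) (X ij @^-1` [set A ij.1 ij.2]).
Proof.
apply/seteqP; split => [w /= <- [i j] _ /=|w Xw]; first by rewrite mxE.
by apply/matrixP => i j; rewrite mxE; apply: (Xw (i, j)); rewrite /= inE.
Qed.

Lemma random_mx_measurable (A : 'M['F_p]_n) :
  measurable (random_mx X @^-1` [set A]).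
Proof.
rewrite random_mx_preimage; apply: fin_bigcap_measurable => [|ij _].
  exact: finite_finset.
exact: measurable_funPTI.
Qed.

Lemma random_mx_prob (A : 'M['F_p]_n) :
  P (random_mx X @^-1` [set A]) = (\prod_(ij : 'I_n * 'I_n) law (A ij.1 ij.2))%:E.
Proof.
have [indep_X copies] := X_iid.
rewrite random_mx_preimage.
have -> := indep_X [set: 'I_n * 'I_n]%SET (fun ij => [set A ij.1 ij.2]) (fun _ _ => I).
rewrite -prodEFin (eq_bigl xpredT) => [|ij]; last by rewrite inE.
apply: eq_bigr => ij _; rewrite -lawE.
exact: (copies ij [set A ij.1 ij.2]).
Qed.

Lemma random_mx_event (Q : pred 'M['F_p]_n) :
  P [set w | Q (random_mx X w)] = (prob_mx law Q)%:E.
Proof.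
rewrite (probability_finite_range P random_mx_measurable).
rewrite /prob_mx -sumEFin; apply: eq_bigr => A _.
exact: random_mx_prob.
Qed.

Lemma random_mx_event_itv (Q : pred 'M['F_p]_n) :
  0 <= fine (P [set w | Q (random_mx X w)]) <= 1.
Proof.
have mQ := measurable_finite_range random_mx_measurable Q.
rewrite fine_ge0 ?measure_ge0 //= -lee_fin fineK ?fin_num_measure //.
exact: probability_le1.
Qed.

End Reduction.

(** * Choice of the constants and the final estimate *)

(** Otherwise all masses would be nonpositive, against their sum 1. *)
Lemma balanced_lt1 (R : realType) (p : nat) (alpha : R) (d0 : measure_display)
    (T0 : measurableType d0) (P0 : probability T0 R) (xi : {RV P0 >-> 'F_p}) :
  balanced alpha xi -> alpha < 1.
Proof.
move=> xi_bal; rewrite ltNge; apply/negP => a1.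
have : \sum_a law xi a <= 0.
  by apply: sumr_le0 => a _; apply: le_trans (law_le xi_bal a) _; rewrite subr_le0.
by rewrite law_sum1 leNgt ltr01.
Qed.

Theorem theorem1p7 (R : realType) :
  exists C : nat -> nat,
  forall (alpha eps : R) (phi : {poly int}),
    0 < alpha -> 0 < eps < 1 ->
  exists c K : R, 0 < c /\
  forall (n p : nat),
    prime p ->
    (C (deg phi) <= p)%N ->
    p%:R <= n%:R `^ ((1 - eps) / 2) :> R ->
    irreducible_poly (poly_mod p phi) ->
  forall (d0 : measure_display) (T0 : measurableType d0)
    (P0 : probability T0 R) (xi : {RV P0 >-> 'F_p}),
    balanced alpha xi ->
  forall (d : measure_display) (T : measurableType d)
    (P : probability T R) (X : 'I_n * 'I_n -> {RV P >-> 'F_p}),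
    iid_copies X xi ->
  `| fine (P [set w | poly_mod p phi %| det_subX (random_mx X w)])
     - (1 - infinite_prod
              (fun i => 1 - p%:R ^- (i * deg (poly_mod p phi)))) |
  <= K * expR (- (c * (n%:R `^ (1 - eps) / p%:R ^+ 2))).

Proof.
exists (fun=> 0%N) => alpha eps phi alpha0 eps01.
have [a1|a1] := ltP alpha 1; last first.
  exists 1, 0; split => // n p _ _ _ _ d0 T0 P0 xi xi_bal.
  by have := balanced_lt1 xi_bal; rewrite ltNge a1.
have a01 : 0 < alpha < 1 by rewrite alpha0.
have [n0 err] := total_error_asymptotics (size phi) a01 eps01.
(* The summand 6 serves n >= n0, and [expR (c * n0)] the smaller n. *)
pose c := alpha / 4; exists c, (6 + expR (c * n0)).
have c0 : 0 < c by rewrite divr_gt0.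
split=> // n p p_pr _ p_le phi_irr d0 T0 P0 xi xi_bal d T P X X_iid.
set phip := poly_mod p phi; set dp := deg phip.
have p1 : (1 < p)%N := prime_gt1 p_pr.
(* The degree may drop modulo p, but [size phi] bounds it for all p at once. *)
have dp_range : (0 < dp <= size phi)%N.
  rewrite /dp /deg; have [sz _] := phi_irr.
  by rewrite -subn1 subn_gt0 sz /= leq_subLR (leq_trans (size_poly _ _)) ?leqnSn.
set prodinf := infinite_prod _; set prob := fine _.
have x_range : 0 <= ((p ^ dp)%:R^-1 : R) <= 2^-1.
  rewrite invr_ge0 ler0n /= lef_pV2 ?posrE ?ltr0n ?expn_gt0 ?(ltnW p1) //.
  rewrite ler_nat; case/andP: dp_range; case: (dp) => // k _ _.
  by rewrite expnS (leq_trans p1) // leq_pmulr // expn_gt0 ltnW.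
have powE i : p%:R ^- (i * dp) = (p ^ dp)%:R^-1 ^+ i :> R.
  by rewrite exprVn mulnC exprM natrX.
have prodinfE : prodinf = infinite_prod (fun i => 1 - ((p ^ dp)%:R^-1 : R) ^+ i).
  by rewrite /prodinf; congr infinite_prod; apply/funext => i; rewrite powE.
have [n_big|n_small] := leP n0 n%:R.
  have [m /andP[m0 mn] err_m] := err n p dp p1 dp_range p_le n_big.
  apply: le_trans (_ : 6 * expR (- (c * (n%:R `^ (1 - eps) / p%:R ^+ 2))) <= _); last first.
    by rewrite ler_wpM2r ?expR_ge0 // lerDl expR_ge0.
  apply: le_trans err_m.
  pose rho := expR (- (alpha / p%:R ^+ 2)).
  have rho01 : 0 <= rho <= 1.
    by rewrite expR_ge0 /= -[leRHS]expR0 ler_expR oppr_le0 divr_ge0 ?exprn_ge0 // ltW.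
  have rho_sq : 1 - 2 * alpha / p%:R ^+ 2 <= rho ^+ 2.
    rewrite -expRM_natl; apply: le_trans (expR_ge1Dx _).
    by rewrite mulrN mulrA.
  have := prob_charpoly_approx p_pr phi_irr (@law_ge0 _ _ _ _ _ xi) (law_sum1 xi)
    (ltW alpha0) (law_le xi_bal) rho01 rho_sq m0 mn.
  have -> : prob_mx (law xi) (fun A : 'M['F_p]_n => phip %| det_subX A) = prob.
    by have /(congr1 fine) := random_mx_event X_iid (fun A => phip %| det_subX A).
  have := infinite_prod_tail n x_range; rewrite -prodinfE.
  have -> : \prod_(1 <= i < n.+1) (1 - p%:R ^- (i * deg phip)) =
      \prod_(1 <= i < n.+1) (1 - ((p ^ dp)%:R^-1 : R) ^+ i).
    by apply: eq_bigr => i _; rewrite powE.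
  set pn := \prod_(1 <= i < n.+1) _ => tail_le approx.
  rewrite (_ : prob - (1 - prodinf) = (prob - (1 - pn)) - (pn - prodinf)); last by ring.
  by apply: le_trans (ler_normB _ _) _; rewrite lerD // -exprVn.
have prob01 : 0 <= prob <= 1 := random_mx_event_itv X (fun A => phip %| det_subX A).
have inf01 : 0 <= prodinf <= 1.
  rewrite prodinfE; apply: infinite_prod_itv => i; have [x0 x2] := andP x_range.
  have x1 : (p ^ dp)%:R^-1 <= 1 :> R.
    by apply: le_trans x2 _; rewrite invf_le1 // ler1n.
  by rewrite subr_ge0 exprn_ile1 //= gerBl exprn_ge0.
(* For n < n0 the left side is a difference of two numbers in [0, 1], while n^(1 - eps) / p^2 <= n <
   n0 makes the right side at least 1. *)
apply: le_trans (_ : 1 <= _).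
  have [prob0 prob1] := andP prob01; have [inf0 inf1] := andP inf01.
  rewrite ler_norml opprB addrA; apply/andP; split.
    by rewrite lerBrDr addNr addr_ge0.
  by rewrite lerBlDr lerD.
apply: le_trans (_ : expR (c * n0) * expR (- (c * (n%:R `^ (1 - eps) / p%:R ^+ 2))) <= _).
  rewrite -expRD -[leLHS]expR0 ler_expR -mulrBr mulr_ge0 //; first exact: ltW.
  rewrite subr_ge0; apply: le_trans (ltW n_small).
  have p2 : 1 <= p%:R ^+ 2 :> R by rewrite exprn_ege1 // ler1n ltnW.
  have [eps_gt0 eps_lt1] := andP eps01.
  apply: le_trans (_ : n%:R `^ (1 - eps) <= _).
    by rewrite ler_pdivrMr ?(lt_le_trans ltr01) // ler_peMr ?powR_ge0.
  have [->|n_gt0] := posnP n; first by rewrite powR0 // gt_eqF ?subr_gt0.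
  rewrite -[leRHS]powRr1 // ler_powR ?ler1n //.
  by rewrite gerBl ltW.
by rewrite ler_wpM2r ?expR_ge0 // lerDr.
Qed.
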